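(* Let $X \in \mathbb{R}^{m \times n}$ with $m \le n$ and $\operatorname{rank} X = m$, let $k \in \{m,\dots,n\}$ be the sampling parameter, and let $c > 1$. Let $\mathcal{S}$ be the index set of cardinality $k$ produced by the Advanced initialization algorithm (described in the context). If the Dominant-split algorithm is called on $X$ with starting set $\mathcal{S}$ and parameter $c$, it requires no more than $O(nm^2/\log c)$ total arithmetic operations. If instead the Dominant algorithm is called on $X$ with starting set $\mathcal{S}$ and parameter $c$, it requires no more than $O(nkm/\log c)$ total arithmetic operations.
   Context: Notation: $X_{\mathcal{S}}$ is the submatrix of $X$ formed by the columns with indices in $\mathcal{S}$; $x_j$ is the $j$-th column of $X$; $\mathrm{Vol}(X_{\mathcal{S}}) = \sqrt{\det(X_{\mathcal{S}}X_{\mathcal{S}}^T)}$; $\mathcal{S}+s-r = (\mathcal{S}\cup\{s\})\setminus\{r\}$. CPQR (column pivoted QR) applied to $X$: iteratively, $m$ times, select the column which has the largest component (in Euclidean norm) orthogonal to the already selected columns. Dominant-split algorithm. Input: $X\in\mathbb{R}^{m\times n}$ ($m\le n$) of rank $m$, a starting set $\mathcal{S}\subseteq\{1,\dots,n\}$ with $|\mathcal{S}|=k\ge m$ and $\operatorname{rank}X_{\mathcal{S}}=m$, and a parameter $c\ge 1$. 1. (Optional, for numerical stability) Compute the LQ decomposition $X = LQ$, where $L \in \mathbb{R}^{m\times m}$ and $Q \in \mathbb{R}^{m \times n}$ has orthonormal rows, and replace $X$ by $Q$. 2. Set $Y \gets (X_{\mathcal{S}}X_{\mathcal{S}}^T)^{-1}$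 and $l_j \gets x_j^T Y x_j$ for $j=1,\dots,n$. 3. Loop: (a) select $s \in \operatorname{argmax}_{j\notin\mathcal{S}} l_j$; (b) set $l'_j \gets l_j - (x_s^T Y x_j)^2/(1+l_s)$ for all $j$, and $Y' \gets Y - Yx_sx_s^TY/(1+l_s)$; (c) select $r \in \operatorname{argmin}_{j\in\mathcal{S}} l'_j$; (d) if $(1+l_s)(1-l'_r) \le c^2$, stop and return $\mathcal{S}$; (e) otherwise set $\mathcal{S}\gets \mathcal{S}+s-r$, $l_j \gets l'_j + (x_r^TY'x_j)^2/(1-l'_r)$ for all $j$, and $Y \gets Y' + Y'x_rx_r^TY'/(1-l'_r)$. Dominant algorithm (known from earlier work). Input as for Dominant-split. It iteratively replaces $\mathcal{S}$ by $\mathcal{S}+s-r$, where the pair $r\in\mathcal{S}$, $s\notin\mathcal{S}$ is chosen to maximize $\mathrm{Vol}(X_{\mathcal{S}+s-r})$, and terminates once $c\,\mathrm{Vol}(X_{\mathcal{S}}) \ge \max_{s\notin\mathcal{S},\, r\in\mathcal{S}} \mathrm{Vol}(X_{\mathcal{S}+s-r})$. The scores for all possible swaps are updated through the iterations, so that one iteration costs $O(nk)$. Advanced initialization algorithm. Input: $X\in\mathbb{R}^{m\times n}$ ($m\le n$) of rank $m$, sampling parameter $k\in\{m,\dots,n\}$, parameter $c \ge 1$ (step 2 below uses its own fixed value instead). Output: an index set of cardinality $k$. 1. Run CPQR on $X$ to obtain an index set $\mathcal{I}$ of cardinality $m$. 2. Run the Dominant-split algorithm on $X$ with an initial index set containing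 $\mathcal{I}$, of cardinality $2m-1$, and with its parameter given by $c^2 = \min\left(e,\ 1 + \frac{2m}{2m-1}\right)$. Let $\mathcal{S}$ be the obtained set. 3. Set $Y \gets (X_{\mathcal{S}}X_{\mathcal{S}}^T)^{-1}$ and $l_j \gets x_j^TYx_j$ for $j=1,\dots,n$. 4. If $k\le 2m-1$: greedily remove $2m-1-k$ columns from $\mathcal{S}$, each time removing $r\in\operatorname{argmin}_{j\in\mathcal{S}} l_j$, updating $Y$ by the Sherman–Morrison formula and $l$ by $l_j \gets l_j + (x_r^TYx_j)^2/(1-l_r)$ (with the values of $Y$, $l$ before the removal on the right). Otherwise: greedily append $k-(2m-1)$ columns, each time adding $s\in\operatorname{argmax}_{j\notin\mathcal{S}} l_j$, updating $Y$ by the Sherman–Morrison formula and $l$ by $l_j \gets l_j - (x_s^TYx_j)^2/(1+l_s)$ (with the values of $Y$, $l$ before the addition on the right). 5. Return $\mathcal{S}$.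
   Formalization: The bounds are proved with min(1, log c) in place of log c, since set-up cost makes the literal bounds fail as c grows; they agree for 1 < c ≤ e. The starting size 2m−1 is capped at n when n < 2m−1. *)

(* Defs.v *)
From HB Require Import structures.
From mathcomp Require Import all_boot all_order all_algebra.
From mathcomp Require Import reals sequences exp.

Set Implicit Arguments.
Unset Strict Implicit.
Unset Printing Implicit Defensive.

Import Order.TTheory GRing.Theory Num.Theory.

Local Open Scope ring_scope.

(* Cost model: exact real arithmetic.  A value is paired with the number of
   arithmetic operations (+, -, *, /, square root, comparison; one unit each)
   spent on it.  Reading, copying and indexing are free. *)
Definition counted (A : Type) : Type := (A * nat)%type.

Definition cret (A : Type) (a : A) : counted A := (a, 0%N).

Definition cbind (A B : Type) (a : counted A) (f : A -> counted B) :
    counted B :=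
  ((f a.1).1, (a.2 + (f a.1).2)%N).

Notation "'let*' x := a 'in' b" := (cbind a (fun x => b))
  (at level 200, x name, a at level 200, b at level 200,
   format "'[v' 'let*'  x  :=  a  'in' '/' b ']'").

Definition cadd (R : realType) (a b : counted R) : counted R :=
  (a.1 + b.1, (a.2 + b.2).+1).
Definition csub (R : realType) (a b : counted R) : counted R :=
  (a.1 - b.1, (a.2 + b.2).+1).
Definition cmul (R : realType) (a b : counted R) : counted R :=
  (a.1 * b.1, (a.2 + b.2).+1).
Definition cdiv (R : realType) (a b : counted R) : counted R :=
  (a.1 / b.1, (a.2 + b.2).+1).
Definition csqrt (R : realType) (a : counted R) : counted R :=
  (Num.sqrt a.1, a.2.+1).
Definition cle (R : realType) (a b : counted R) : counted bool :=
  (a.1 <= b.1, (a.2 + b.2).+1).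

(* Accumulation starting from 0: one addition per term. *)
Definition csum (R : realType) (I : finType) (A : {set I})
    (f : I -> counted R) : counted R :=
  (\sum_(i in A) (f i).1, (\sum_(i in A) (f i).2.+1)%N).

Declare Scope counted_scope.
Delimit Scope counted_scope with cnt.
Notation "$ x" := (cret x) (at level 9, x at level 9, format "$ x") :
  counted_scope.
Notation "x + y" := (cadd x y) : counted_scope.
Notation "x - y" := (csub x y) : counted_scope.
Notation "x * y" := (cmul x y) : counted_scope.
Notation "x / y" := (cdiv x y) : counted_scope.
Notation "x <= y" := (cle x y) : counted_scope.

(* The table of all [f i], [i \in A]; entries outside [A] are not computed and
   hold the dummy value 0. *)
Definition tabulate (R : realType) (I : finType) (A : {set I})
    (f : I -> counted R) : counted {ffun I -> R} :=
  ([ffun i => if i \in A then (f i).1 else 0], (\sum_(i in A) (f i).2)%N).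

Definition cmatrix (R : realType) (p q : nat) (f : 'I_p -> 'I_q -> counted R) :
    counted 'M[R]_(p, q) :=
  (\matrix_(i, j) (f i j).1, (\sum_(i < p) \sum_(j < q) (f i j).2)%N).

Definition cmulmx (R : realType) (p q t : nat) (A : 'M[R]_(p, q))
    (B : 'M[R]_(q, t)) : counted 'M[R]_(p, t) :=
  cmatrix (fun i j => csum [set: 'I_q] (fun a => ($(A i a) * $(B a j))%cnt)).

(* Inversion by bordering: with A = [[a, b], [d, D]], E = D^-1 and the Schur
   complement z = a - b E d,
   A^-1 = [[1/z, - b E / z], [- E d / z, E + (E d) (b E) / z]].
   No pivoting is needed when A is symmetric positive definite. *)
Fixpoint cinv (R : realType) (p : nat) : 'M[R]_p -> counted 'M[R]_p :=
  match p with
  | 0 => fun A => cret A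
  | p'.+1 => fun A : 'M[R]_(1 + p') =>
      let a := ulsubmx A in
      let* E := cinv (drsubmx A) in
      let* u := cmulmx (ursubmx A) E in
      let* w := cmulmx E (dlsubmx A) in
      let* t := cmulmx u (dlsubmx A) in
      let* z := ($(a ord0 ord0) - $(t ord0 ord0))%cnt in
      let* ul := cmatrix (fun _ _ : 'I_1 => ($1 / $z)%cnt) in
      let* ur := cmatrix (fun (_ : 'I_1) j => ($0 - $(u ord0 j) / $z)%cnt) in
      let* dl := cmatrix (fun i (_ : 'I_1) => ($0 - $(w i ord0) / $z)%cnt) in
      let* dr := cmatrix (fun i j =>
                   ($(E i j) + $(w i ord0) * $(u ord0 j) / $z)%cnt) in
      cret (block_mx ul ur dl dr : 'M[R]_(1 + p'))
  end.

(* Modified Gram-Schmidt on the rows of X yields the factor Q of X = L Q; the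
   entries of the lower triangular L are the inner products and the norms
   computed on the way. *)
Definition gs_project (R : realType) (n : nat) (v q : 'rV[R]_n) :
    counted 'rV[R]_n :=
  let* a := csum [set: 'I_n] (fun j => ($(v ord0 j) * $(q ord0 j))%cnt) in
  cmatrix (fun (_ : 'I_1) j => ($(v ord0 j) - $a * $(q ord0 j))%cnt).

Fixpoint gs_reduce (R : realType) (n : nat) (v : 'rV[R]_n)
    (qs : seq 'rV[R]_n) : counted 'rV[R]_n :=
  if qs is q :: qs' then let* v' := gs_project v q in gs_reduce v' qs'
  else cret v.

Definition gs_normalize (R : realType) (n : nat) (v : 'rV[R]_n) :
    counted 'rV[R]_n :=
  let* a := csqrt (csum [set: 'I_n]
                     (fun j => ($(v ord0 j) * $(v ord0 j))%cnt)) in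
  cmatrix (fun (_ : 'I_1) j => ($(v ord0 j) / $a)%cnt).

Fixpoint gs_rows (R : realType) (n : nat) (xs qs : seq 'rV[R]_n) :
    counted (seq 'rV[R]_n) :=
  if xs is x :: xs' then
    let* v := gs_reduce x qs in
    let* q := gs_normalize v in
    gs_rows xs' (rcons qs q)
  else cret qs.

Definition lq_factor (R : realType) (m n : nat) (X : 'M[R]_(m, n)) :
    counted 'M[R]_(m, n) :=
  let* qs := gs_rows [seq row i X | i <- enum 'I_m] [::] in
  cret (\matrix_(i < m) nth 0 qs i).

(* Programs with nondeterministic choices (arbitrary tie-breaking):
   [p a t] means that some execution of [p] returns [a] after exactly [t]
   arithmetic operations. *)
Definition program (A : Type) : Type := A -> nat -> Prop.

Definition run (A : Type) (x : counted A) : program A :=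
  fun a t => a = x.1 /\ t = x.2.

Definition ret (A : Type) (a : A) : program A := run (cret a).

Definition bind (A B : Type) (p : program A) (f : A -> program B) : program B :=
  fun b t => exists a t1 t2, [/\ p a t1, f a b t2 & t = (t1 + t2)%N].

Notation "'let!' x := a 'in' b" := (bind a (fun x => b))
  (at level 200, x name, a at level 200, b at level 200,
   format "'[v' 'let!'  x  :=  a  'in' '/' b ']'").

Definition argmax (R : realType) (I : finType) (A : {set I})
    (f : {ffun I -> R}) : program I :=
  fun s t => [/\ s \in A, forall j, j \in A -> f j <= f s & t = #|A|].

Definition argmin (R : realType) (I : finType) (A : {set I})
    (f : {ffun I -> R}) : program I :=
  fun r t => [/\ r \in A, forall j, j \in A -> f r <= f j & t = #|A|].

(* At most [N] rounds; [None] means that the loop has not stopped by then. *)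
Fixpoint loop (St A : Type) (body : St -> program (St + A)) (N : nat)
    (st : St) : program (option A) :=
  if N is N'.+1 then
    let! x := body st in
    match x with
    | inl st' => loop body N' st'
    | inr a => ret (Some a)
    end
  else ret None.

Definition outputs (A : Type) (p : nat -> program (option A)) (a : A) : Prop :=
  exists N t, p N (Some a) t.

(* Whatever the choices made, the program stops, having spent at most [B]
   arithmetic operations in total. *)
Definition halts_within (R : realType) (A : Type)
    (p : nat -> program (option A)) (B : R) : Prop :=
  exists N, (exists o t, p N o t) /\
    forall o t, p N o t -> o <> None /\ t%:R <= B.

Definition colset (R : realType) (m n : nat) (X : 'M[R]_(m, n))
    (S : {set 'I_n}) : 'M[R]_(m, #|S|) :=
  \matrix_(i < m, j < #|S|) X i (enum_val j).

Definition Vol (R : realType) (m n : nat) (X : 'M[R]_(m, n))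
    (S : {set 'I_n}) : R :=
  Num.sqrt (\det (colset X S *m (colset X S)^T)).

Definition swap (n : nat) (S : {set 'I_n}) (s r : 'I_n) : {set 'I_n} :=
  (s |: S) :\ r.

Notation scores R m n := ('M[R]_m * {ffun 'I_n -> R})%type (only parsing).

(* Y = (X_S X_S^T)^-1 and l_j = x_j^T Y x_j. *)
Definition init_scores (R : realType) (m n : nat) (X : 'M[R]_(m, n))
    (S : {set 'I_n}) : counted (scores R m n) :=
  let* G := cmulmx (colset X S) (colset X S)^T in
  let* Y := cinv G in
  let* l := tabulate [set: 'I_n] (fun j =>
              csum [set: 'I_m] (fun a => ($(X a j) *
                csum [set: 'I_m] (fun b => $(Y a b) * $(X b j)))%cnt)) in
  cret (Y, l).

(* Sherman-Morrison updates of (Y, l) when the column s enters, resp. the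
   column r leaves, the index set; v_j is x_s^T Y x_j, resp. x_r^T Y x_j. *)
Definition add_column (R : realType) (m n : nat) (X : 'M[R]_(m, n)) (s : 'I_n)
    (Yl : scores R m n) : counted (scores R m n) :=
  let Y := Yl.1 in let l := Yl.2 in
  let* u := cmulmx Y (col s X) in
  let* w := cmulmx (col s X)^T Y in
  let* v := cmulmx w X in
  let* d := ($1 + $(l s))%cnt in
  let* l' := tabulate [set: 'I_n] (fun j =>
               ($(l j) - $(v ord0 j) * $(v ord0 j) / $d)%cnt) in
  let* Y' := cmatrix (fun a b =>
               ($(Y a b) - $(u a ord0) * $(w ord0 b) / $d)%cnt) in
  cret (Y', l').

Definition remove_column (R : realType) (m n : nat) (X : 'M[R]_(m, n))
    (r : 'I_n) (Yl : scores R m n) : counted (scores R m n) :=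
  let Y := Yl.1 in let l := Yl.2 in
  let* u := cmulmx Y (col r X) in
  let* w := cmulmx (col r X)^T Y in
  let* v := cmulmx w X in
  let* d := ($1 - $(l r))%cnt in
  let* l' := tabulate [set: 'I_n] (fun j =>
               ($(l j) + $(v ord0 j) * $(v ord0 j) / $d)%cnt) in
  let* Y' := cmatrix (fun a b =>
               ($(Y a b) + $(u a ord0) * $(w ord0 b) / $d)%cnt) in
  cret (Y', l').

(* When S contains all the columns there is no swap, and the loop stops. *)
Definition dominant_split_body (R : realType) (m n : nat) (X : 'M[R]_(m, n))
    (c : R) (st : {set 'I_n} * scores R m n) :
    program ({set 'I_n} * scores R m n + {set 'I_n}) :=
  let S := st.1 in let Yl := st.2 in
  if ~: S == set0 then ret (inr S) else
  let! s := argmax (~: S) Yl.2 in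
  let! Yl' := run (add_column X s Yl) in
  let! r := argmin S Yl'.2 in
  let! stop := run (($1 + $(Yl.2 s)) * ($1 - $(Yl'.2 r)) <= $c * $c)%cnt in
  if stop then ret (inr S) else
  let! Yl'' := run (remove_column X r Yl') in
  ret (inl (swap S s r, Yl'')).

(* [lq] tells whether the optional LQ preprocessing is performed. *)
Definition dominant_split (R : realType) (m n : nat) (lq : bool)
    (X : 'M[R]_(m, n)) (S : {set 'I_n}) (c : R) (N : nat) :
    program (option {set 'I_n}) :=
  let! X' := run (if lq then lq_factor X else cret X) in
  let! Yl := run (init_scores X' S) in
  loop (dominant_split_body X' c) N (S, Yl).

Inductive dominant_result (R : realType) (m n : nat) (X : 'M[R]_(m, n))
    (c : R) : {set 'I_n} -> {set 'I_n} -> Prop :=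
| Dominant_stop (S : {set 'I_n}) :
    (forall s r, s \notin S -> r \in S -> Vol X (swap S s r) <= c * Vol X S) ->
    dominant_result X c S S
| Dominant_swap (S S' : {set 'I_n}) (s r : 'I_n) :
    s \notin S -> r \in S ->
    (forall s' r', s' \notin S -> r' \in S ->
       Vol X (swap S s' r') <= Vol X (swap S s r)) ->
    c * Vol X S < Vol X (swap S s r) ->
    dominant_result X c (swap S s r) S' ->
    dominant_result X c S S'.

(* The implementation of Dominant keeps l_j = x_j^T Y x_j for all j and
   C_ij = x_i^T Y x_j for i in S and all j, where Y = (X_S X_S^T)^-1.
   By the matrix determinant lemma,
   Vol(X_{S+s-r})^2 / Vol(X_S)^2 = (1 + l_s) (1 - l_r) + C_rs^2. *)
Notation swap_scores R n :=
  ({ffun 'I_n -> R} * {ffun 'I_n * 'I_n -> R})%type (only parsing).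

Definition init_swap_scores (R : realType) (m n : nat) (X : 'M[R]_(m, n))
    (S : {set 'I_n}) : counted (swap_scores R n) :=
  let* G := cmulmx (colset X S) (colset X S)^T in
  let* Y := cinv G in
  let* W := cmulmx Y X in
  let* l := tabulate [set: 'I_n] (fun j =>
              csum [set: 'I_m] (fun a => ($(X a j) * $(W a j))%cnt)) in
  let* C := tabulate (setX S [set: 'I_n]) (fun ij =>
              csum [set: 'I_m] (fun a => ($(X a ij.1) * $(W a ij.2))%cnt)) in
  cret (l, C).

(* d_j = x_s^T Y x_j is recovered as the sum of C_is C_ij over i in S, since
   X_S X_S^T Y = 1; [Cs] is [C] with this row s adjoined. *)
Definition update_swap_scores (R : realType) (n : nat) (S : {set 'I_n})
    (s r : 'I_n) (lC : swap_scores R n) : counted (swap_scores R n) :=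
  let l := lC.1 in let C := lC.2 in
  let* d := tabulate [set: 'I_n] (fun j =>
              csum S (fun i => ($(C (i, s)) * $(C (i, j)))%cnt)) in
  let Cs i j := if i == s then d j else C (i, j) in
  let* q := ($1 + $(l s))%cnt in
  let* l' := tabulate [set: 'I_n] (fun j =>
               ($(l j) - $(d j) * $(d j) / $q)%cnt) in
  let* C' := tabulate (setX (s |: S) [set: 'I_n]) (fun ij =>
               ($(Cs ij.1 ij.2) - $(Cs ij.1 s) * $(d ij.2) / $q)%cnt) in
  let* q' := ($1 - $(l' r))%cnt in
  let* l'' := tabulate [set: 'I_n] (fun j =>
                ($(l' j) + $(C' (r, j)) * $(C' (r, j)) / $q')%cnt) in
  let* C'' := tabulate (setX (swap S s r) [set: 'I_n]) (fun ij =>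
                ($(C' ij) + $(C' (ij.1, r)) * $(C' (r, ij.2)) / $q')%cnt) in
  cret (l'', C'').

Definition dominant_body (R : realType) (n : nat) (c : R)
    (st : {set 'I_n} * swap_scores R n) :
    program ({set 'I_n} * swap_scores R n + {set 'I_n}) :=
  let S := st.1 in let l := st.2.1 in let C := st.2.2 in
  if ~: S == set0 then ret (inr S) else
  let! f := run (tabulate (setX S (~: S)) (fun rs =>
              (($1 + $(l rs.2)) * ($1 - $(l rs.1)) + $(C rs) * $(C rs))%cnt)) in
  let! rs := argmax (setX S (~: S)) f in
  let! stop := run ($(f rs) <= $c * $c)%cnt in
  if stop then ret (inr S) else
  let! lC := run (update_swap_scores S rs.2 rs.1 st.2) in
  ret (inl (swap S rs.2 rs.1, lC)).

Definition dominant (R : realType) (m n : nat) (X : 'M[R]_(m, n))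
    (S : {set 'I_n}) (c : R) (N : nat) : program (option {set 'I_n}) :=
  let! lC := run (init_swap_scores X S) in
  loop (dominant_body c) N (S, lC).

Definition enorm (R : realType) (m : nat) (z : 'cV[R]_m) : R :=
  Num.sqrt (\sum_(i < m) z i ord0 ^+ 2).

(* z is the component of x orthogonal to the columns of X indexed by I. *)
Definition orth_component (R : realType) (m n : nat) (X : 'M[R]_(m, n))
    (I : {set 'I_n}) (x z : 'cV[R]_m) : Prop :=
  (forall i, i \in I -> (col i X)^T *m z = 0) /\
  exists a : 'I_n -> R, x = z + \sum_(i in I) a i *: col i X.

(* The index sets that CPQR may have selected after t rounds. *)
Inductive cpqr (R : realType) (m n : nat) (X : 'M[R]_(m, n)) :
    nat -> {set 'I_n} -> Prop :=
| Cpqr_start : cpqr X 0 set0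
| Cpqr_select (t : nat) (I : {set 'I_n}) (s : 'I_n) (zs : 'cV[R]_m) :
    cpqr X t I -> s \notin I ->
    orth_component X I (col s X) zs ->
    (forall j z, j \notin I -> orth_component X I (col j X) z ->
       enorm z <= enorm zs) ->
    cpqr X t.+1 (s |: I).

Fixpoint greedy_remove (R : realType) (m n : nat) (X : 'M[R]_(m, n)) (t : nat)
    (S : {set 'I_n}) (Yl : scores R m n) : program {set 'I_n} :=
  if t is t'.+1 then
    let! r := argmin S Yl.2 in
    let! Yl' := run (remove_column X r Yl) in
    greedy_remove X t' (S :\ r) Yl'
  else ret S.

Fixpoint greedy_append (R : realType) (m n : nat) (X : 'M[R]_(m, n)) (t : nat)
    (S : {set 'I_n}) (Yl : scores R m n) : program {set 'I_n} :=
  if t is t'.+1 then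
    let! s := argmax (~: S) Yl.2 in
    let! Yl' := run (add_column X s Yl) in
    greedy_append X t' (s |: S) Yl'
  else ret S.

Definition advanced_init_parameter (R : realType) (m : nat) : R :=
  Num.sqrt (Num.min (expR 1) (1 + (2 * m)%:R / (2 * m - 1)%:R)).

(* [advanced_init lq X k S]: S is a possible output with sampling parameter k.
   The size 2m-1 is capped by n: for n < 2m-1 the intermediate set consists of
   all the columns. *)
Definition advanced_init (R : realType) (m n : nat) (lq : bool)
    (X : 'M[R]_(m, n)) (k : nat) (S : {set 'I_n}) : Prop :=
  let p := minn (2 * m - 1) n in
  exists I S0 S1 : {set 'I_n},
    [/\ cpqr X m I, I \subset S0, #|S0| = p,
        outputs (dominant_split lq X S0 (advanced_init_parameter R m)) S1 &
        exists t,
          (if (k <= p)%N then greedy_remove X (p - k) S1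
           else greedy_append X (k - p) S1) (init_scores X S1).1 S t].

(* Main.v *)
Require Import Defs.
From HB Require Import structures.
From mathcomp Require Import all_boot all_order all_algebra.
From mathcomp Require Import reals sequences exp.
From mathcomp Require Import ring lra zify.

Set Implicit Arguments.
Unset Strict Implicit.
Unset Printing Implicit Defensive.

Import Order.TTheory GRing.Theory Num.Theory.

Local Open Scope ring_scope.

(* All quantities are determinants of G_S = X_S X_S^T, whose square roots are
   the volumes.  For any T, applying Hadamard's inequality and AM-GM to G_T in
   coordinates where G_S = 1 gives
   det G_T <= det G_S (sum_(j in T) l_j / m)^m, where l_j = x_j^T G_S^-1 x_j.
   When Dominant-split stops on 2m-1 columns, sum_(j in S + s) l'_j = m forces
   l_j <= 3 for all j.  Hence any k columns have det at most (3k/m)^m det G_S,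
   and the greedy phase turns this into det G_T <= 24^m det G_S for its output
   S and every T of size k.  Every swap multiplies det G_S by more than c^2, so
   both algorithms stop after O(m / min(1, ln c)) rounds. *)

(** * Positive definite matrices *)

(** What the initialization buys is that the gain still possible, 24^m, depends on neither n nor k,
    so the number of swaps depends on m and c alone. For appended columns a step-by-step loss would
    compound to a factor depending on k; m-th roots of the determinants avoid this, since both the
    gap to the optimum and the gain of a step are then linear in the largest score. The programs
    branch on scores that are updated incrementally. The invariants therefore say that the stored
    scores are the exact ones of the current set, so that each test compares determinants. This
    needs 1 - l_r > 0 at each removal: after a successful test it holds because the gain exceeds c^2
    >= 0, in the greedy removals because the smallest score is at most the average m / #|S| < 1. The
    bounds divide by min(1, ln c), since for large c the initial scores and one round still have to
    be paid for. *)

Definition posdef (R : numDomainType) (p : nat) (A : 'M[R]_p) : Prop :=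
  A^T = A /\ forall u : 'rV[R]_p, u != 0 -> 0 < (u *m A *m u^T) ord0 ord0.

Lemma posdef_unit (R : numFieldType) (p : nat) (A : 'M[R]_p) :
  posdef A -> A \in unitmx.
Proof.
move=> [_ pA]; rewrite -row_free_unit; apply: inj_row_free => v vA.
by apply/eqP/contraT => /pA; rewrite vA mul0mx mxE ltxx.
Qed.

Lemma posdef_inv (R : numFieldType) (p : nat) (A : 'M[R]_p) :
  posdef A -> posdef (invmx A).
Proof.
move=> pA; have uA := posdef_unit pA; case: pA => sA pA.
have sV : (invmx A)^T = invmx A by rewrite trmx_inv sA.
split=> // u u0; have := pA (u *m invmx A).
rewrite trmx_mul sV mulmxKV // mulmxA; apply.
by apply: contra u0 => /eqP e; rewrite -(mulmxKV uA u) e mul0mx.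
Qed.

Lemma posdef_dr (R : numDomainType) (p : nat) (A : 'M[R]_(1 + p)) :
  posdef A -> posdef (drsubmx A).
Proof.
move=> [sA pA]; split; first by rewrite trmx_drsub sA.
move=> u u0; have := pA (row_mx 0 u).
rewrite -{1}[A]submxK mul_row_block tr_row_mx mul_row_col.
rewrite !(mul0mx, add0r) trmx0 mulmx0 add0r; apply.
by apply: contra u0 => /eqP /(congr1 rsubmx); rewrite row_mxKr linear0 => ->.
Qed.

(** The lower right block is eliminated because [cinv] recurses on it; this complement is the pivot
    [z] computed there. *)
Definition schur (R : fieldType) (p : nat) (A : 'M[R]_(1 + p)) : 'M[R]_1 :=
  ulsubmx A - ursubmx A *m invmx (drsubmx A) *m dlsubmx A.

Definition schur_mx (R : fieldType) (p : nat) (A : 'M[R]_(1 + p)) :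
    'M[R]_(1 + p) :=
  block_mx 1%:M (- (ursubmx A *m invmx (drsubmx A))) 0 1%:M.

Lemma schur_diag (R : fieldType) (p : nat) (A : 'M[R]_(1 + p)) :
  A^T = A -> drsubmx A \in unitmx ->
  schur_mx A *m A *m (schur_mx A)^T = block_mx (schur A) 0 0 (drsubmx A).
Proof.
move=> sA uD; rewrite /schur /schur_mx.
have sD : (drsubmx A)^T = drsubmx A by rewrite trmx_drsub sA.
have sd : dlsubmx A = (ursubmx A)^T by rewrite trmx_ursub sA.
rewrite -{3}[A]submxK tr_block_mx !mulmx_block !trmx1 !trmx0 linearN /=.
rewrite trmx_mul trmx_inv sD -sd.
rewrite !(mul1mx, mul0mx, mulmx1, mulmx0, add0r, addr0) !mulNmx.
by rewrite mulmxKV // subrr mul0mx addr0 mulmxN mulKVmx // subrr.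
Qed.

Lemma det_schur (R : fieldType) (p : nat) (A : 'M[R]_(1 + p)) :
  A^T = A -> drsubmx A \in unitmx ->
  \det A = schur A ord0 ord0 * \det (drsubmx A).
Proof.
move=> sA uD; have /(congr1 determinant) := schur_diag sA uD.
rewrite !det_mulmx det_tr det_ublock !det1 !mul1r mulr1 => ->.
by rewrite det_ublock det_mx11.
Qed.

(** The complement is the quadratic form of [A] at the top row of [schur_mx A], which starts with 1
    and so is not zero. *)
Lemma schur_gt0 (R : numFieldType) (p : nat) (A : 'M[R]_(1 + p)) :
  posdef A -> 0 < schur A ord0 ord0.
Proof.
move=> pA; have uD := posdef_unit (posdef_dr pA).
have := schur_diag pA.1 uD; case: (pA) => sA pA' /(congr1 ulsubmx).
rewrite block_mxKul => <-.
suff -> : ulsubmx (schur_mx A *m A *m (schur_mx A)^T) =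
  usubmx (schur_mx A) *m A *m (usubmx (schur_mx A))^T.
  apply: pA'; rewrite /schur_mx block_mxEv col_mxKu.
  apply/negP => /eqP /(congr1 lsubmx) /matrixP /(_ ord0 ord0).
  by rewrite row_mxKl linear0 !mxE eqxx => /eqP; rewrite oner_eq0.
by rewrite /ulsubmx -!mul_usub_mx trmx_usub mulmx_lsub.
Qed.

(** [W] is the inverse of a triangular factor of [A]: clear the off-diagonal blocks with
    [schur_mx A], scale the pivot by its inverse root, and recurse on the lower block. *)
Lemma cholesky (R : rcfType) (p : nat) (A : 'M[R]_p) :
  posdef A -> exists W : 'M[R]_p, W *m A *m W^T = 1%:M.
Proof.
elim: p A => [A _|p IH A pA]; first by exists 1%:M; apply/matrixP => -[].
change ('M[R]_(1 + p)) in A; have pD := posdef_dr pA.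
have [W WD] := IH _ pD; pose z := schur A ord0 ord0.
have z0 : 0 < z by apply: schur_gt0.
exists ((block_mx ((Num.sqrt z)^-1)%:M 0 0 W : 'M_(1 + p)) *m schur_mx A).
set B := block_mx _ _ _ _.
have -> : B *m schur_mx A *m A *m (B *m schur_mx A)^T =
   B *m (schur_mx A *m A *m (schur_mx A)^T) *m B^T by rewrite trmx_mul !mulmxA.
rewrite schur_diag ?pA.1 //; last exact: posdef_unit.
rewrite /B tr_block_mx !mulmx_block !trmx0.
rewrite !(mul0mx, mulmx0, addr0, add0r) WD tr_scalar_mx.
rewrite [schur A]mx11_scalar -/z -!scalar_mxM.
have -> : (Num.sqrt z)^-1 * z * (Num.sqrt z)^-1 = 1 :> R.
  rewrite mulrAC -invfM -expr2 sqr_sqrtr ?ltW // mulVf //.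
  by rewrite gt_eqF.
by symmetry; exact: (@scalar_mx_block _ 1 p).
Qed.

Lemma posdef_det_gt0 (R : numFieldType) (p : nat) (A : 'M[R]_p) :
  posdef A -> 0 < \det A.
Proof.
elim: p A => [A _|p IH A pA]; first by rewrite det_mx00.
change ('M[R]_(1 + p)) in A; have pD := posdef_dr pA.
rewrite det_schur ?pA.1 ?posdef_unit //.
by rewrite mulr_gt0 ?IH ?schur_gt0.
Qed.

(** The pivot a - b D^-1 b^T split off by [det_schur] is at most the corner entry a, because D^-1 is
    positive definite. *)
Lemma hadamard (R : numFieldType) (p : nat) (A : 'M[R]_p) :
  posdef A -> \det A <= \prod_i A i i.
Proof.
elim: p A => [A _|p IH A pA]; first by rewrite det_mx00 big_ord0.
change ('M[R]_(1 + p)) in A; have pD := posdef_dr pA.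
rewrite det_schur ?pA.1 ?posdef_unit // big_ord_recl.
have e0 : lshift p (ord0 : 'I_1) = ord0 by apply/val_inj.
apply: ler_pM.
- by rewrite ltW // schur_gt0.
- by rewrite ltW // posdef_det_gt0.
- rewrite /schur mxE /ulsubmx !mxE e0 gerDl oppr_le0.
  have sd : dlsubmx A = (ursubmx A)^T by rewrite trmx_ursub pA.1.
  have -> : \sum_j (ursubmx A *m invmx (drsubmx A)) ord0 j * dlsubmx A j ord0 =
    (ursubmx A *m invmx (drsubmx A) *m (ursubmx A)^T) ord0 ord0.
    by rewrite mxE; apply: eq_bigr => j _; rewrite sd.
  have [->|b0] := eqVneq (ursubmx A) 0; first by rewrite !mul0mx mxE.
  by rewrite ltW // (posdef_inv pD).2.
- apply: le_trans (IH _ pD) _; rewrite le_eqVlt; apply/orP; left; apply/eqP.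
  apply: eq_bigr => i _; rewrite !mxE.
  by have -> : rshift 1 i = lift ord0 i by apply/val_inj.
Qed.

Lemma det1D_colrow (R : comUnitRingType) (p : nat) (u : 'cV[R]_p)
    (v : 'rV[R]_p) : \det (1%:M + u *m v) = 1 + (v *m u) ord0 ord0.
Proof.
(* Multiplying [A] by the same unit triangular matrix on the right or on the left makes it block
   triangular, with the two determinants as results. *)
pose A : 'M_(1 + p) := block_mx 1%:M (- v) u 1%:M.
have e1 : A *m block_mx 1%:M v 0 1%:M = block_mx 1%:M 0 u (1%:M + u *m v).
  rewrite mulmx_block !(mul1mx, mulmx1, mulmx0, addr0) subrr.
  by rewrite [u *m v + _]addrC.
have e2 : block_mx 1%:M v 0 1%:M *m A = block_mx (1%:M + v *m u) 0 u 1%:M.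
  by rewrite mulmx_block !(mul1mx, mulmx1, mul0mx, add0r) addNr.
have : \det (A *m block_mx 1%:M v 0 1%:M) = \det (block_mx 1%:M v 0 1%:M *m A).
  by rewrite !det_mulmx mulrC.
rewrite e1 e2 !det_lblock !det1 mul1r mulr1 => ->.
by rewrite det_mx11 !mxE eqxx.
Qed.

(** The matrix determinant lemma; [e] is 1 for an entering column and -1 for a leaving one. *)
Lemma det_rank1_update (R : comUnitRingType) (p : nat) (M : 'M[R]_p)
    (x : 'cV[R]_p) (e : R) : M \in unitmx ->
  \det (M + e *: (x *m x^T)) =
  \det M * (1 + e * (x^T *m invmx M *m x) ord0 ord0).
Proof.
move=> uM.
have -> : M + e *: (x *m x^T) = M *m (1%:M + (e *: (invmx M *m x)) *m x^T).
  by rewrite mulmxDr mulmx1 -scalemxAl -!scalemxAr !mulmxA mulmxV // mul1mx.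
by rewrite det_mulmx det1D_colrow -scalemxAr mxE mulmxA.
Qed.

Lemma sherman_morrison (R : fieldType) (p : nat) (M : 'M[R]_p)
    (x : 'cV[R]_p) (e : R) (d := 1 + e * (x^T *m invmx M *m x) ord0 ord0) :
  M \in unitmx -> d != 0 ->
  invmx (M + e *: (x *m x^T)) =
  invmx M - (e / d) *: (invmx M *m x *m (x^T *m invmx M)).
Proof.
move=> uM d0; set Y := invmx M; set N := M + _.
have uN : N \in unitmx.
  by rewrite unitmxE det_rank1_update // unitfE mulf_neq0 // -unitfE -unitmxE.
suff e1 : N *m (Y - (e / d) *: (Y *m x *m (x^T *m Y))) = 1%:M.
  by rewrite -[LHS]mulmx1 -e1 mulKmx.
rewrite mulmxBr !mulmxDl mulmxV //.
rewrite -!scalemxAr -!scalemxAl mulmxA mulKVmx // -!mulmxA.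
rewrite [x^T *m (Y *m (x *m _))]mulmxA [x^T *m Y *m (x *m _)]mulmxA.
have -> : x^T *m Y *m x = ((x^T *m Y *m x) ord0 ord0)%:M by apply: mx11_scalar.
set q := (_ ord0 ord0); rewrite mul_scalar_mx -scalemxAr.
set Z := x *m (x^T *m Y).
rewrite !scalerA -addrA -[RHS]addr0; congr (_ + _).
rewrite -scalerDl -scalerBl; apply/eqP; rewrite scaler_eq0; apply/orP; left.
by apply/eqP; move: d0; rewrite /d -/Y -/q => d0; field.
Qed.

Lemma mulmx_tr_eq0 (R : realDomainType) (p q : nat) (B : 'M[R]_(p, q)) :
  B *m B^T = 0 -> B = 0.
Proof.
move=> B0; apply/matrixP => i j; rewrite mxE; apply/eqP.
have := congr1 (fun M : 'M_p => M i i) B0; rewrite !mxE => /eqP.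
rewrite psumr_eq0; last by move=> a _; rewrite !mxE -expr2 sqr_ge0.
by move=> /allP /(_ j (mem_index_enum _)); rewrite mxE mulf_eq0 orbb.
Qed.

(** * Gram matrices and scores *)

(** As a sum of rank-one terms it involves no matrix with [#|S|] columns, and moving a column in or
    out adds or subtracts one term. *)
Definition gram (R : pzRingType) (m n : nat) (X : 'M[R]_(m, n))
    (S : {set 'I_n}) : 'M[R]_m :=
  \sum_(j in S) col j X *m (col j X)^T.

(** The diagonal entries are the scores l_j, the others the entries C_ij kept by Dominant. They have
    this meaning only when the Gram matrix is invertible, as [invmx] returns a singular matrix
    unchanged. *)
Definition lev (R : comUnitRingType) (m n : nat) (X : 'M[R]_(m, n))
    (S : {set 'I_n}) (i j : 'I_n) : R :=
  ((col i X)^T *m invmx (gram X S) *m col j X) ord0 ord0.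

Lemma colset_gram (R : realType) (m n : nat) (X : 'M[R]_(m, n))
    (S : {set 'I_n}) : colset X S *m (colset X S)^T = gram X S.
Proof.
apply/matrixP => a b; rewrite mxE /gram summxE [RHS]big_enum_val /=.
by apply: eq_bigr => i _; rewrite !mxE big_ord1 !mxE.
Qed.

Lemma gram_sym (R : comPzRingType) (m n : nat) (X : 'M[R]_(m, n))
    (S : {set 'I_n}) : (gram X S)^T = gram X S.
Proof.
rewrite /gram linear_sum /=; apply: eq_bigr => j _.
by rewrite trmx_mul trmxK.
Qed.

Lemma col_mulmx (R : pzSemiRingType) (m n p : nat) (A : 'M[R]_(m, n))
    (B : 'M[R]_(n, p)) (j : 'I_p) : col j (A *m B) = A *m col j B.
Proof. by rewrite !colE mulmxA. Qed.

Lemma gram_mull (R : comPzRingType) (m p n : nat) (L : 'M[R]_(p, m))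
    (X : 'M[R]_(m, n)) (S : {set 'I_n}) :
  gram (L *m X) S = L *m gram X S *m L^T.
Proof.
rewrite /gram mulmx_sumr mulmx_suml; apply: eq_bigr => j _.
by rewrite !col_mulmx trmx_mul !mulmxA.
Qed.

Lemma gram_form (R : comPzRingType) (m n : nat) (X : 'M[R]_(m, n))
    (S : {set 'I_n}) (u : 'rV[R]_m) :
  (u *m gram X S *m u^T) ord0 ord0 =
  \sum_(j in S) (u *m col j X) ord0 ord0 ^+ 2.
Proof.
rewrite /gram mulmx_sumr mulmx_suml summxE; apply: eq_bigr => j _.
rewrite mulmxA -mulmxA -trmx_mul mxE big_ord1 [in X in _ * X]mxE.
by rewrite expr2.
Qed.

(** The hypothesis says that the columns in [S] span the space; the form at u is the sum of the
    squares (u x_j)^2. *)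
Lemma gram_posdef (R : realDomainType) (m n : nat) (X : 'M[R]_(m, n))
    (S : {set 'I_n}) :
  (forall u : 'rV[R]_m, (forall j, j \in S -> u *m col j X = 0) -> u = 0) ->
  posdef (gram X S).
Proof.
move=> inj; split=> [|u u0]; first exact: gram_sym.
rewrite gram_form lt0r sumr_ge0 ?andbT; last by move=> *; rewrite sqr_ge0.
apply: contra u0 => /eqP e; apply/eqP/inj => j jS.
have /eqP : (u *m col j X) ord0 ord0 ^+ 2 = 0.
  by move: e => /(psumr_eq0P _) -> // i _; rewrite sqr_ge0.
by rewrite sqrf_eq0 => /eqP e0; rewrite [u *m _]mx11_scalar e0 raddf0.
Qed.

Lemma gram_unit_inj (R : comUnitRingType) (m n : nat) (X : 'M[R]_(m, n))
    (S : {set 'I_n}) (u : 'rV[R]_m) : gram X S \in unitmx ->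
  (forall j, j \in S -> u *m col j X = 0) -> u = 0.
Proof.
move=> uG uX; rewrite -(mulmxK uG u) /gram mulmx_sumr big1 ?mul0mx // => j jS.
by rewrite mulmxA uX // mul0mx.
Qed.

Lemma gram_unit_posdef (R : realFieldType) (m n : nat) (X : 'M[R]_(m, n))
    (S : {set 'I_n}) : gram X S \in unitmx -> posdef (gram X S).
Proof. by move=> uG; apply: gram_posdef => u; apply: gram_unit_inj. Qed.

Lemma gram_unit_sub (R : realFieldType) (m n : nat) (X : 'M[R]_(m, n))
    (S T : {set 'I_n}) : S \subset T -> gram X S \in unitmx ->
  gram X T \in unitmx.
Proof.
move=> /subsetP ST uS; apply/posdef_unit/gram_posdef => u uT.
by apply: (gram_unit_inj uS) => j /ST; apply: uT.
Qed.

Lemma det_gram_gt0 (R : realFieldType) (m n : nat) (X : 'M[R]_(m, n))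
    (S : {set 'I_n}) : gram X S \in unitmx -> 0 < \det (gram X S).
Proof. by move/gram_unit_posdef/posdef_det_gt0. Qed.

Lemma det_gram_ge0 (R : realFieldType) (m n : nat) (X : 'M[R]_(m, n))
    (S : {set 'I_n}) : 0 <= \det (gram X S).
Proof.
have [/det_gram_gt0/ltW //|] := boolP (gram X S \in unitmx).
by rewrite unitmxE unitfE negbK => /eqP ->.
Qed.

Lemma gramU1 (R : comPzRingType) (m n : nat) (X : 'M[R]_(m, n))
    (S : {set 'I_n}) (s : 'I_n) : s \notin S ->
  gram X (s |: S) = gram X S + 1 *: (col s X *m (col s X)^T).
Proof. by move=> sS; rewrite /gram big_setU1 //= scale1r addrC. Qed.

Lemma gramD1 (R : comPzRingType) (m n : nat) (X : 'M[R]_(m, n))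
    (S : {set 'I_n}) (r : 'I_n) : r \in S ->
  gram X (S :\ r) = gram X S + (-1) *: (col r X *m (col r X)^T).
Proof.
move=> rS; rewrite {2}/gram (big_setD1 r rS) /= scaleN1r.
by rewrite [LHS]/gram addrAC subrr add0r.
Qed.

(** Both sides are the trace of G_S G_S^-1. It fixes the average score over [S] at m / #|S|, from
    which the smallest score is bounded later. *)
Lemma lev_sum (R : comUnitRingType) (m n : nat) (X : 'M[R]_(m, n))
    (S : {set 'I_n}) : gram X S \in unitmx ->
  \sum_(j in S) lev X S j j = m%:R.
Proof.
move=> uG; rewrite -(mxtrace1 R m) -(mulmxV uG) {2}/gram mulmx_suml.
rewrite linear_sum /=; apply: eq_bigr => j _.
rewrite -mulmxA mxtrace_mulC.
by rewrite /mxtrace big_ord1.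
Qed.

Lemma lev_sym (R : comUnitRingType) (m n : nat) (X : 'M[R]_(m, n))
    (S : {set 'I_n}) (i j : 'I_n) : lev X S i j = lev X S j i.
Proof.
rewrite /lev.
transitivity (((col i X)^T *m invmx (gram X S) *m col j X)^T ord0 ord0).
  by rewrite [RHS]mxE.
by rewrite !trmx_mul trmxK trmx_inv gram_sym mulmxA.
Qed.

Lemma lev_ge0 (R : realFieldType) (m n : nat) (X : 'M[R]_(m, n))
    (S : {set 'I_n}) (j : 'I_n) : gram X S \in unitmx -> 0 <= lev X S j j.
Proof.
move=> /gram_unit_posdef/posdef_inv [_ pY]; rewrite /lev.
have [->|/pY] := eqVneq (col j X)^T 0; first by rewrite !mul0mx mxE.
by rewrite trmxK => /ltW.
Qed.

Lemma det_gramU1 (R : comUnitRingType) (m n : nat) (X : 'M[R]_(m, n))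
    (S : {set 'I_n}) (s : 'I_n) : gram X S \in unitmx -> s \notin S ->
  \det (gram X (s |: S)) = \det (gram X S) * (1 + lev X S s s).
Proof. by move=> uG sS; rewrite gramU1 // det_rank1_update // mul1r. Qed.

Lemma det_gramD1 (R : comUnitRingType) (m n : nat) (X : 'M[R]_(m, n))
    (S : {set 'I_n}) (r : 'I_n) : gram X S \in unitmx -> r \in S ->
  \det (gram X (S :\ r)) = \det (gram X S) * (1 - lev X S r r).
Proof. by move=> uG rS; rewrite gramD1 // det_rank1_update // mulN1r. Qed.

Lemma gram_unitD1 (R : realFieldType) (m n : nat) (X : 'M[R]_(m, n))
    (S : {set 'I_n}) (r : 'I_n) : gram X S \in unitmx -> r \in S ->
  lev X S r r < 1 -> gram X (S :\ r) \in unitmx.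
Proof.
move=> uG rS l1; rewrite unitmxE unitfE det_gramD1 // mulf_neq0 //.
  by rewrite gt_eqF // det_gram_gt0.
by rewrite gt_eqF // subr_gt0.
Qed.

(** Removing j multiplies the determinant by 1 - l_j, and the result is still nonnegative. *)
Lemma lev_le1 (R : realFieldType) (m n : nat) (X : 'M[R]_(m, n))
    (S : {set 'I_n}) (j : 'I_n) : gram X S \in unitmx -> j \in S ->
  lev X S j j <= 1.
Proof.
move=> uG jS; have := det_gram_ge0 X (S :\ j).
by rewrite det_gramD1 // pmulr_rge0 ?det_gram_gt0 // subr_ge0.
Qed.

Lemma lev_rank1_update (R : fieldType) (m n : nat) (X : 'M[R]_(m, n))
    (S T : {set 'I_n}) (e : R) (r i j : 'I_n) :
  gram X T = gram X S + e *: (col r X *m (col r X)^T) ->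
  gram X S \in unitmx -> 1 + e * lev X S r r != 0 ->
  lev X T i j =
  lev X S i j - e * (lev X S i r * lev X S r j / (1 + e * lev X S r r)).
Proof.
move=> eT uG d0; rewrite /lev eT sherman_morrison // -/(lev X S r r).
rewrite mulmxBr mulmxBl -scalemxAr -scalemxAl [LHS]mxE [X in _ + X = _]mxE.
rewrite [X in - X]mxE -/(lev X S i j).
have -> : (col i X)^T *m (invmx (gram X S) *m col r X *m
    ((col r X)^T *m invmx (gram X S))) *m col j X =
  ((col i X)^T *m invmx (gram X S) *m col r X) *m
    ((col r X)^T *m invmx (gram X S) *m col j X) by rewrite !mulmxA.
rewrite [X in _ / _ * X]mxE big_ord1 -/(lev X S i r) -/(lev X S r j).
by rewrite -mulrA [_^-1 * _]mulrC.
Qed.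

Lemma levU1 (R : realFieldType) (m n : nat) (X : 'M[R]_(m, n))
    (S : {set 'I_n}) (s i j : 'I_n) : gram X S \in unitmx -> s \notin S ->
  lev X (s |: S) i j =
  lev X S i j - lev X S i s * lev X S s j / (1 + lev X S s s).
Proof.
move=> uG sS; rewrite (lev_rank1_update _ _ (gramU1 X sS)) ?mul1r //.
by rewrite gt_eqF // ltr_pwDl // lev_ge0.
Qed.

Lemma levD1 (R : realFieldType) (m n : nat) (X : 'M[R]_(m, n))
    (S : {set 'I_n}) (r i j : 'I_n) : gram X S \in unitmx -> r \in S ->
  lev X S r r < 1 ->
  lev X (S :\ r) i j =
  lev X S i j + lev X S i r * lev X S r j / (1 - lev X S r r).
Proof.
move=> uG rS l1; rewrite (lev_rank1_update _ _ (gramD1 X rS)) ?mulN1r ?opprK //.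
by rewrite gt_eqF // subr_gt0.
Qed.

Lemma levU1_le (R : realFieldType) (m n : nat) (X : 'M[R]_(m, n))
    (S : {set 'I_n}) (s j : 'I_n) : gram X S \in unitmx -> s \notin S ->
  lev X (s |: S) j j <= lev X S j j.
Proof.
move=> uG sS; rewrite levU1 // gerBl [lev X S j s]lev_sym -expr2.
by rewrite divr_ge0 ?sqr_ge0 // addr_ge0 // lev_ge0.
Qed.

(* Whitening by W with W G_S W^T = 1 turns the scores into the squared norms of
   the columns, whose sum over T is the trace of the whitened G_T. *)
Lemma det_gram_le (R : rcfType) (m n : nat) (X : 'M[R]_(m, n))
    (S T : {set 'I_n}) : gram X S \in unitmx ->
  \det (gram X T) <=
  \det (gram X S) * ((\sum_(j in T) lev X S j j) / m%:R) ^+ m.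
Proof.
(* Hadamard's inequality needs G_T positive definite; when G_T is singular the left side is 0. *)
move=> uS; have [uT|] := boolP (gram X T \in unitmx); last first.
  rewrite unitmxE unitfE negbK => /eqP ->.
  rewrite mulr_ge0 ?det_gram_ge0 // exprn_ge0 // divr_ge0 //.
  by apply: sumr_ge0 => j _; apply: lev_ge0.
have [W WS] := cholesky (gram_unit_posdef uS).
have uW : W \in unitmx by case/mulmx1_unit: WS => _; rewrite unitmx_tr.
have dW : \det (gram X S) * \det W ^+ 2 = 1.
  by rewrite -(det1 R m) -WS !det_mulmx det_tr; ring.
have WW : W^T *m W = invmx (gram X S).
  have e : gram X S *m (W^T *m W) = 1%:M.
    by rewrite mulmxA; apply: mulmx1C; rewrite mulmxA.
  by rewrite -[LHS](mulKmx uS) e mulmx1.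
have uWT : gram (W *m X) T \in unitmx.
  by rewrite gram_mull !unitmx_mul uW uT unitmx_tr.
have tr : \sum_i gram (W *m X) T i i = \sum_(j in T) lev X S j j.
  rewrite -[LHS]/(\tr (gram (W *m X) T)) /gram linear_sum /=.
  apply: eq_bigr => j _; rewrite mxtrace_mulC /mxtrace big_ord1 /lev -WW.
  by rewrite col_mulmx trmx_mul !mulmxA.
have dWT : \det (gram X T) = \det (gram X S) * \det (gram (W *m X) T).
  transitivity ((\det (gram X S) * \det W ^+ 2) * \det (gram X T)).
    by rewrite dW mul1r.
  by rewrite gram_mull !det_mulmx det_tr; ring.
rewrite dWT ler_pM2l ?det_gram_gt0 //.
apply: le_trans (hadamard (gram_unit_posdef uWT)) _.
have pos : {in 'I_m, forall i, 0 <= gram (W *m X) T i i}.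
  move=> i _; rewrite /gram summxE; apply: sumr_ge0 => j _.
  by rewrite mxE; apply: sumr_ge0 => a _; rewrite !mxE -expr2 sqr_ge0.
by have [+ _] := leif_AGM pos; rewrite /= card_ord tr.
Qed.

(** * Values and costs of the elementary programs *)

Lemma cbind1 (A B : Type) (a : counted A) (f : A -> counted B) :
  (cbind a f).1 = (f a.1).1.
Proof. by []. Qed.

Lemma cbind2 (A B : Type) (a : counted A) (f : A -> counted B) :
  (cbind a f).2 = (a.2 + (f a.1).2)%N.
Proof. by []. Qed.

Lemma csum_cost (R : realType) (I : finType) (A : {set I})
    (f : I -> counted R) (d : nat) :
  (forall i, (f i).2 = d) -> (csum A f).2 = (#|A| * d.+1)%N.
Proof.
by move=> fd; rewrite /= -sum_nat_const; apply: eq_bigr => i _; rewrite fd.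
Qed.

Lemma tabulate_cost (R : realType) (I : finType) (A : {set I})
    (f : I -> counted R) (d : nat) :
  (forall i, (f i).2 = d) -> (tabulate A f).2 = (#|A| * d)%N.
Proof.
by move=> fd; rewrite /= -sum_nat_const; apply: eq_bigr => i _; rewrite fd.
Qed.

Lemma cmatrix_cost (R : realType) (p q : nat) (f : 'I_p -> 'I_q -> counted R)
    (d : nat) : (forall i j, (f i j).2 = d) -> (cmatrix f).2 = (p * (q * d))%N.
Proof.
move=> fd; rewrite /= -[in RHS](card_ord p) -sum_nat_const.
apply: eq_bigr => i _; rewrite -[in RHS](card_ord q) -sum_nat_const.
by apply: eq_bigr => j _; rewrite fd.
Qed.

Lemma cmulmx_val (R : realType) (p q t : nat) (A : 'M[R]_(p, q))
    (B : 'M[R]_(q, t)) : (cmulmx A B).1 = A *m B.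
Proof.
by apply/matrixP => i j; rewrite !mxE /=; apply: eq_bigl => a; rewrite inE.
Qed.

Lemma cmulmx_cost (R : realType) (p q t : nat) (A : 'M[R]_(p, q))
    (B : 'M[R]_(q, t)) : (cmulmx A B).2 = (p * (t * (q * 2)))%N.
Proof.
apply: cmatrix_cost => i j; rewrite (csum_cost _ (d := 1)) //.
by rewrite cardsT card_ord.
Qed.

Lemma cinv_val (R : realType) (p : nat) (A : 'M[R]_p) :
  posdef A -> (cinv A).1 = invmx A.
Proof.
elim: p A => [A _|p IH A pA]; first by apply/matrixP => -[].
change ('M[R]_(1 + p)) in A; have pD := posdef_dr pA.
have uD := posdef_unit pD; have uA := posdef_unit pA.
rewrite [cinv A]/= !cbind1 IH // !cmulmx_val.
set D := drsubmx A in uD *; set E := invmx D.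
set u := ursubmx A *m E; set w := E *m dlsubmx A.
have z0 : 0 < schur A ord0 ord0 by exact: schur_gt0.
set z := (_ - _)%cnt; have -> : z.1 = schur A ord0 ord0.
  by rewrite /schur [RHS]mxE [X in _ = _ + X]mxE.
move: (schur A ord0 ord0) z0 (mx11_scalar (schur A)) => y y0 {z}.
rewrite /schur -/D -/E -/u => zE.
have y1 : y != 0 by rewrite gt_eqF.
(* A right inverse suffices. The product is checked from the relations [bw], [aE], [bE], [Dw] and
   [DE] alone, with the blocks made opaque. *)
suff e : A *m block_mx (y^-1)%:M (- (y^-1 *: u)) (- (y^-1 *: w))
    (E + y^-1 *: (w *m u)) = 1%:M.
  rewrite -[RHS]mulmx1 -e mulKmx //.
  apply: (f_equal4 (@block_mx R 1 p 1 p)); apply/matrixP => i j.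
  - by rewrite !ord1 !mxE /= mul1r ?mulr1n.
  - by rewrite !ord1 !mxE /= sub0r mulrC.
  - by rewrite !ord1 !mxE /= sub0r mulrC.
  - by clearbody E u w; rewrite !mxE /= big_ord1 mulrC.
have bw : ursubmx A *m w = u *m dlsubmx A by rewrite mulmxA.
have aE : ulsubmx A = y%:M + u *m dlsubmx A by rewrite -zE subrK.
have bE : ursubmx A *m E = u by [].
have Dw : D *m w = dlsubmx A by rewrite mulKVmx.
have DE : D *m E = 1%:M by rewrite mulmxV.
rewrite -{1}[A]submxK mulmx_block -/D aE.
clearbody u w E; rewrite !(mulmxN, mulmxDr) -!scalemxAr.
rewrite [ursubmx A *m (w *m u)]mulmxA [D *m (w *m u)]mulmxA bw Dw bE DE.
rewrite !mul_mx_scalar !mulmxDl !mul_scalar_mx.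
rewrite !scalerDr !scalerA mulVf // scale_scalar_mx mulVf // scale1r addrK.
by rewrite addNr subrr [1%:M + _]addrC addKr; symmetry; exact: scalar_mx_block.
Qed.

Lemma cinv_cost (R : realType) (p : nat) (A : 'M[R]_p) :
  ((cinv A).2 <= 7 * p ^ 3)%N.
Proof.
elim: p A => // p IH A; change ('M[R]_(1 + p)) in A.
rewrite [cinv A]/= !cbind2 !cmulmx_cost.
rewrite (cmatrix_cost (d := 1)) // (cmatrix_cost (d := 2)) //.
rewrite (cmatrix_cost (d := 2)) // (cmatrix_cost (d := 3)) //.
(* Bordering a block of size p costs 7 p^2 + 6 p + 2, below the increment 21 p^2 + 21 p + 7 of 7
   p^3. *)
have := IH (drsubmx A); rewrite !expnS !expn0 /=; move: (cinv _).2 => a.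
rewrite !add0n; nia.
Qed.

Lemma lev_mulmx (R : comUnitRingType) (m n : nat) (X : 'M[R]_(m, n))
    (S : {set 'I_n}) (i j : 'I_n) :
  ((col i X)^T *m invmx (gram X S) *m X) ord0 j = lev X S i j.
Proof.
transitivity (col j ((col i X)^T *m invmx (gram X S) *m X) ord0 ord0).
  by rewrite [RHS]mxE.
by rewrite col_mulmx.
Qed.

Lemma lev_sumE (R : comUnitRingType) (m n : nat) (X : 'M[R]_(m, n))
    (S : {set 'I_n}) (i j : 'I_n) :
  \sum_a X a i * (invmx (gram X S) *m X) a j = lev X S i j.
Proof.
rewrite -lev_mulmx -mulmxA [RHS]mxE.
by apply: eq_bigr => a _; rewrite [in X in _ = X * _]mxE [in X in _ = X * _]mxE.
Qed.

(** The state that the incremental updates have to reproduce; the loop invariants are equalities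
    with it. *)
Definition exact_scores (R : comUnitRingType) (m n : nat) (X : 'M[R]_(m, n))
    (S : {set 'I_n}) : 'M[R]_m * {ffun 'I_n -> R} :=
  (invmx (gram X S), [ffun j => lev X S j j]).

Lemma init_scores_val (R : realType) (m n : nat) (X : 'M[R]_(m, n))
    (S : {set 'I_n}) : gram X S \in unitmx ->
  (init_scores X S).1 = exact_scores X S.
Proof.
move=> uG; rewrite /init_scores !cbind1 cmulmx_val colset_gram.
rewrite cinv_val; last exact: gram_unit_posdef.
congr (_, _); apply/ffunP => j; rewrite !ffunE inE /= -lev_sumE.
apply: eq_big => a; first by rewrite inE.
move=> _; rewrite [in RHS]mxE; congr (_ * _).
by apply: eq_bigl => b; rewrite inE.
Qed.

Lemma init_scores_cost (R : realType) (m n : nat) (X : 'M[R]_(m, n))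
    (S : {set 'I_n}) : (0 < m)%N -> (m <= n)%N ->
  ((init_scores X S).2 <= 13 * (n * m ^ 2))%N.
Proof.
move=> m0 mn; rewrite /init_scores !cbind2 cmulmx_cost.
rewrite (tabulate_cost _ (d := (m * (m * 2 + 2))%N)); last first.
  move=> j; rewrite (csum_cost _ (d := (m * 2 + 1)%N)).
    by rewrite cardsT card_ord addn1 addn2.
  move=> a; rewrite /cmul [(csum _ _).2](csum_cost _ (d := 1)) //.
  by rewrite cardsT card_ord /= addn1.
have := cinv_cost (cmulmx (colset X S) (colset X S)^T).1.
have := max_card (mem S); rewrite cardsT card_ord /= !expnS !expn0.
move: (cinv _).2 => a; move: #|S| => k kn ha.
(* 13 = 2 + 7 + 4: the Gram product, the inverse, and the scores with 2 n m^2 + 2 n m. *)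
have h1 : (m * m * k <= n * m * m)%N by nia.
have h2 : (m * m * m <= n * m * m)%N by nia.
have h3 : (n * m <= n * m * m)%N by nia.
nia.
Qed.

Lemma add_column_val (R : realType) (m n : nat) (X : 'M[R]_(m, n))
    (S : {set 'I_n}) (s : 'I_n) : gram X S \in unitmx -> s \notin S ->
  (add_column X s (exact_scores X S)).1 = exact_scores X (s |: S).
Proof.
move=> uG sS; rewrite /add_column !cbind1 !cmulmx_val /exact_scores.
have d0 : 1 + 1 * lev X S s s != 0.
  by rewrite mul1r gt_eqF // ltr_pwDl // lev_ge0.
congr (_, _).
  rewrite gramU1 // sherman_morrison //; apply/matrixP => a b.
  rewrite [LHS]mxE [RHS]mxE [X in _ = _ + X]mxE [X in _ = _ - X]mxE.
  rewrite [X in _ = _ - _ * X]mxE big_ord1.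
  by rewrite /= !ffunE !mul1r [_ ^-1 * _]mulrC.
apply/ffunP => j; rewrite !ffunE inE /= lev_mulmx levU1 //.
by rewrite [lev X S j s]lev_sym.
Qed.

Lemma remove_column_val (R : realType) (m n : nat) (X : 'M[R]_(m, n))
    (S : {set 'I_n}) (r : 'I_n) : gram X S \in unitmx -> r \in S ->
  lev X S r r < 1 ->
  (remove_column X r (exact_scores X S)).1 = exact_scores X (S :\ r).
Proof.
move=> uG rS l1; rewrite /remove_column !cbind1 !cmulmx_val /exact_scores.
have d0 : 1 + (-1) * lev X S r r != 0 by rewrite mulN1r gt_eqF // subr_gt0.
congr (_, _).
  rewrite gramD1 // sherman_morrison //; apply/matrixP => a b.
  rewrite [LHS]mxE [RHS]mxE [X in _ = _ + X]mxE [X in _ = _ - X]mxE.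
  rewrite [X in _ = _ - _ * X]mxE big_ord1.
  by rewrite /= !ffunE !mulN1r mulNr opprK [_ ^-1 * _]mulrC.
apply/ffunP => j; rewrite !ffunE inE /= lev_mulmx levD1 //.
by rewrite [lev X S j r]lev_sym.
Qed.

Lemma add_column_cost (R : realType) (m n : nat) (X : 'M[R]_(m, n))
    (s : 'I_n) (Yl : 'M[R]_m * {ffun 'I_n -> R}) : (0 < m <= n)%N ->
  ((add_column X s Yl).2 <= 13 * (n * m))%N.
Proof.
move=> mn; rewrite /add_column !cbind2 !cmulmx_cost.
rewrite (tabulate_cost _ (d := 3)) // (cmatrix_cost (d := 3)) //.
(* The total is 7 m^2 + 2 n m + 3 n + 1, and 7 + 2 + 3 + 1 = 13. *)
rewrite cardsT card_ord /=; nia.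
Qed.

Lemma remove_column_cost (R : realType) (m n : nat) (X : 'M[R]_(m, n))
    (r : 'I_n) (Yl : 'M[R]_m * {ffun 'I_n -> R}) : (0 < m <= n)%N ->
  ((remove_column X r Yl).2 <= 13 * (n * m))%N.
Proof.
move=> mn; rewrite /remove_column !cbind2 !cmulmx_cost.
rewrite (tabulate_cost _ (d := 3)) // (cmatrix_cost (d := 3)) //.
rewrite cardsT card_ord /=; nia.
Qed.

(** The 0 outside the rows of [S] is the dummy value of [tabulate], so that states can be compared
    by plain equality. *)
Definition exact_swap_scores (R : comUnitRingType) (m n : nat)
    (X : 'M[R]_(m, n)) (S : {set 'I_n}) :
    {ffun 'I_n -> R} * {ffun 'I_n * 'I_n -> R} :=
  ([ffun j => lev X S j j],
   [ffun ij => if ij.1 \in S then lev X S ij.1 ij.2 else 0]).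

Lemma init_swap_scores_val (R : realType) (m n : nat) (X : 'M[R]_(m, n))
    (S : {set 'I_n}) : gram X S \in unitmx ->
  (init_swap_scores X S).1 = exact_swap_scores X S.
Proof.
move=> uG; rewrite /init_swap_scores !cbind1 !cmulmx_val colset_gram.
rewrite cinv_val; last exact: gram_unit_posdef.
congr (_, _).
  apply/ffunP => j; rewrite !ffunE /= inE -lev_sumE.
  by apply: eq_bigl => a; rewrite inE.
apply/ffunP => -[i j]; rewrite !ffunE /=.
rewrite in_setX inE andbT -lev_sumE; case: ifP => // _.
by apply: eq_bigl => a; rewrite inE.
Qed.

Lemma init_swap_scores_cost (R : realType) (m n : nat) (X : 'M[R]_(m, n))
    (S : {set 'I_n}) : (0 < m)%N -> (m <= n)%N -> (m <= #|S|)%N ->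
  ((init_swap_scores X S).2 <= 15 * (n * #|S| * m))%N.
Proof.
move=> m0 mn mS; rewrite /init_swap_scores !cbind2 !cmulmx_cost.
rewrite (tabulate_cost _ (d := (m * 2)%N)); last first.
  by move=> j; rewrite (csum_cost _ (d := 1)) // cardsT card_ord.
rewrite (tabulate_cost _ (d := (m * 2)%N)); last first.
  by move=> j; rewrite (csum_cost _ (d := 1)) // cardsT card_ord.
have := cinv_cost (cmulmx (colset X S) (colset X S)^T).1.
have := max_card (mem S); rewrite cardsX cardsT card_ord /= !expnS !expn0.
move: (cinv _).2 => a; move: #|S| mS => k mS kn ha.
(* 15 = 2 + 7 + 2 + 2 + 2: Gram product, inverse, [W], [l] and [C], all brought to the form n #|S| m
   by m <= #|S|. *)
have h1 : (m * (m * k) <= n * k * m)%N by nia.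
have h2 : (m * (m * m) <= n * k * m)%N by nia.
have h3 : (n * m * m <= n * k * m)%N by nia.
have h4 : (n * m <= n * k * m)%N by nia.
nia.
Qed.

(** Write G_S^-1 as G_S^-1 G_S G_S^-1 and expand the middle factor over the columns of [S]. *)
Lemma gram_lev_mul (R : comUnitRingType) (m n : nat) (X : 'M[R]_(m, n))
    (S : {set 'I_n}) (s j : 'I_n) : gram X S \in unitmx ->
  \sum_(i in S) lev X S i s * lev X S i j = lev X S s j.
Proof.
move=> uG; rewrite {3}/lev -[invmx (gram X S) in RHS]mulmx1 -(mulmxV uG).
rewrite {2}/gram mulmx_suml !mulmx_sumr mulmx_suml summxE.
apply: eq_bigr => i _; rewrite [lev X S i s]lev_sym.
set Y := invmx _; rewrite -!mulmxA.
have -> : (col s X)^T *m (Y *m (col i X *m ((col i X)^T *m (Y *m col j X)))) =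
  ((col s X)^T *m Y *m col i X) *m ((col i X)^T *m Y *m col j X).
  by rewrite !mulmxA.
by rewrite mxE big_ord1.
Qed.

Lemma update_swap_scores_val (R : realType) (m n : nat) (X : 'M[R]_(m, n))
    (S : {set 'I_n}) (s r : 'I_n) : gram X S \in unitmx ->
  s \notin S -> r \in S -> lev X (s |: S) r r < 1 ->
  (update_swap_scores S s r (exact_swap_scores X S)).1 =
  exact_swap_scores X (swap S s r).
Proof.
move=> uG sS rS l1; rewrite /update_swap_scores !cbind1.
have E1 j : (exact_swap_scores X S).1 j = lev X S j j by rewrite ffunE.
have E2 i j : i \in S -> (exact_swap_scores X S).2 (i, j) = lev X S i j.
  by move=> iS; rewrite ffunE /= iS.
(* From here on only the rows of [C] in [S] are known, which are all that is read. Each later table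
   is likewise replaced by its specification before the next one is treated. *)
move: (exact_swap_scores X S) E1 E2 => E E1 E2.
set d := (tabulate [set: 'I_n] (fun j => csum S _)).1.
have dE j : d j = lev X S s j.
  rewrite /d ffunE inE /= -(gram_lev_mul s j uG); apply: eq_bigr => i iS.
  by rewrite !E2.
clearbody d; set q := ($1 + $(E.1 s))%cnt.
have qE : q.1 = 1 + lev X S s s by rewrite /q /= E1.
clearbody q; set l' := (tabulate [set: 'I_n] (fun j => $(E.1 j) - _)%cnt).1.
have lE j : l' j = lev X (s |: S) j j.
  by rewrite /l' ffunE inE /= E1 !dE qE levU1 // [lev X S j s]lev_sym.
have CsE i j : i \in s |: S ->
  (if i == s then d j else E.2 (i, j)) = lev X S i j.
  rewrite !inE; case: eqVneq => [->|_] //= iS.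
  exact: E2.
clearbody l'; set C' := (tabulate (setX (s |: S) _) _).1.
have CE i j : i \in s |: S -> C' (i, j) = lev X (s |: S) i j.
  move=> iS; rewrite /C' ffunE in_setX iS inE /= !CsE // dE qE.
  by rewrite levU1.
clearbody C'; set q' := ($1 - $(l' r))%cnt.
have qE' : q'.1 = 1 - lev X (s |: S) r r by rewrite /q' /= lE.
clearbody q'; have rsS : r \in s |: S by rewrite inE rS orbT.
have uGs := gram_unit_sub (subsetUr [set s] S) uG.
congr (_, _).
  apply/ffunP => j; rewrite !ffunE inE /= qE' lE CE // levD1 //.
  by rewrite [lev X _ j r]lev_sym.
apply/ffunP => -[i j]; rewrite !ffunE in_setX in_setT andbT /=.
case: ifP => // /setD1P [_ iS].
by rewrite qE' !CE // levD1.
Qed.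

Lemma update_swap_scores_cost (R : realType) (n : nat) (S : {set 'I_n})
    (s r : 'I_n) (lC : {ffun 'I_n -> R} * {ffun 'I_n * 'I_n -> R}) :
  r \in S -> ((update_swap_scores S s r lC).2 <= 20 * (n * #|S|))%N.
Proof.
move=> rS; rewrite /update_swap_scores !cbind2.
rewrite (tabulate_cost _ (d := (#|S| * 2)%N)); last first.
  by move=> j; rewrite (csum_cost _ (d := 1)).
rewrite !(tabulate_cost _ (d := 3)) //.
rewrite !cardsX cardsT card_ord /= /swap cardsU1.
have := cardsD1 r (s |: S); rewrite cardsU1 inE rS orbT.
(* For s outside [S] the total is 8 n #|S| + 9 n + 2; the lower terms are absorbed because n and
   #|S| are positive. *)
have : (0 < #|S|)%N by apply/card_gt0P; exists r.
have : (0 < n)%N by case: n r {S s lC rS} => [[]|].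
move: #|S| #|_ :\ r| => k k'.
case: (s \notin S) => /=; nia.
Qed.

(** * LQ factorization and CPQR *)

(** Each projection step can be undone inside [A], by adding back a multiple of q, whatever its
    coefficient. *)
Lemma gs_reduce_span (R : realType) (p n : nat) (A : 'M[R]_(p, n))
    (v : 'rV[R]_n) (qs : seq 'rV[R]_n) :
  (forall q, q \in qs -> (q <= A)%MS) -> ((gs_reduce v qs).1 <= A)%MS ->
  (v <= A)%MS.
Proof.
elim: qs v => //= q qs IH v qA /IH h.
have {h} /h vA : forall q, q \in qs -> (q <= A)%MS.
  by move=> q' q'q; apply: qA; rewrite inE q'q orbT.
set a := \sum_(_ in _) _ in vA.
set v' := \matrix_(_, _) _ in vA.
have -> : v = v' + a *: q.
  by apply/rowP => j; rewrite !mxE !ord1 subrK.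
by rewrite addmx_sub // scalemx_sub // qA // inE eqxx.
Qed.

Lemma gs_normalize_span (R : realType) (p n : nat) (A : 'M[R]_(p, n))
    (v : 'rV[R]_n) : ((gs_normalize v).1 <= A)%MS -> (v <= A)%MS.
Proof.
move=> /=; set a := Num.sqrt _; set v' := \matrix_(_, _) _ => vA.
(* If the norm is 0 the normalized row says nothing about [v], but then [v] itself is 0. *)
have [a0|a0] := eqVneq a 0; last first.
  have -> : v = a *: v'.
    by apply/rowP => j; rewrite !mxE !ord1 mulrC divfK.
  by rewrite scalemx_sub.
have -> : v = 0; last exact: sub0mx.
apply/rowP => j; rewrite mxE; apply/eqP; rewrite -sqrf_eq0 expr2 eq_le.
rewrite -expr2 sqr_ge0 andbT.
have : \sum_(i in [set: 'I_n]) v ord0 i * v ord0 i <= 0.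
  by move/eqP: a0; rewrite sqrtr_eq0.
apply: le_trans; rewrite (bigD1 j) ?inE //= -expr2 lerDl.
by apply: sumr_ge0 => i _; rewrite -expr2 sqr_ge0.
Qed.

Lemma gs_rows_span (R : realType) (p n : nat) (A : 'M[R]_(p, n))
    (xs qs : seq 'rV[R]_n) :
  (forall q, q \in (gs_rows xs qs).1 -> (q <= A)%MS) ->
  forall x, x \in qs ++ xs -> (x <= A)%MS.
Proof.
elim: xs qs => [|x xs IH] qs; first by rewrite cats0.
move=> /IH; rewrite -/(gs_reduce x qs) -/(gs_normalize _) => h.
have qA q : q \in qs -> (q <= A)%MS.
  by move=> qq; apply: h; rewrite mem_cat mem_rcons inE qq orbT.
have xA : (x <= A)%MS.
  apply: (gs_reduce_span qA); apply: gs_normalize_span; apply: h.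
  by rewrite mem_cat mem_rcons inE eqxx.
move=> y; rewrite mem_cat inE => /or3P [/qA //|/eqP -> //|yx].
by apply: h; rewrite mem_cat yx orbT.
Qed.

Lemma gs_rows_size (R : realType) (n : nat) (xs qs : seq 'rV[R]_n) :
  size (gs_rows xs qs).1 = (size xs + size qs)%N.
Proof. by elim: xs qs => //= x xs IH qs; rewrite IH size_rcons addnS. Qed.

Lemma gs_project_cost (R : realType) (n : nat) (v q : 'rV[R]_n) :
  (gs_project v q).2 = (4 * n)%N.
Proof.
rewrite /gs_project cbind2 (csum_cost _ (d := 1)) // (cmatrix_cost (d := 2)) //.
by rewrite cardsT card_ord; lia.
Qed.

Lemma gs_reduce_cost (R : realType) (n : nat) (v : 'rV[R]_n)
    (qs : seq 'rV[R]_n) : (gs_reduce v qs).2 = (4 * n * size qs)%N.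
Proof.
elim: qs v => [|q qs IH] v; first by rewrite muln0.
by rewrite [gs_reduce _ _]/= cbind2 gs_project_cost IH /= mulnS.
Qed.

Lemma gs_normalize_cost (R : realType) (n : nat) (v : 'rV[R]_n) :
  (gs_normalize v).2 = (3 * n + 1)%N.
Proof.
rewrite /gs_normalize cbind2 (cmatrix_cost (d := 1)) //.
rewrite [(csqrt _).2](_ : _ = (n * 2).+1); first by lia.
by congr _.+1; rewrite (csum_cost _ (d := 1)) // cardsT card_ord.
Qed.

Lemma gs_rows_cost (R : realType) (n : nat) (xs qs : seq 'rV[R]_n) :
  ((gs_rows xs qs).2 <=
   size xs * (4 * n * (size xs + size qs) + 3 * n + 1))%N.
Proof.
elim: xs qs => // x xs IH qs; cbn [gs_rows].
rewrite cbind2 [X in (_ + X)%N]cbind2.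
rewrite gs_reduce_cost gs_normalize_cost [size (_ :: _)]/=.
move: (IH (rcons qs (gs_normalize (gs_reduce x qs).1).1)).
by rewrite size_rcons; nia.
Qed.

(* Orthonormality of the rows is irrelevant: scores and ratios of volumes are
   the same for X and L^-1 X as soon as L is invertible. *)
Lemma lq_factor_span (R : realType) (m n : nat) (X : 'M[R]_(m, n)) :
  (X <= (lq_factor X).1)%MS.
Proof.
set xs := [seq row i X | i <- enum 'I_m].
have sz : size (gs_rows xs [::]).1 = m.
  by rewrite gs_rows_size addn0 size_map size_enum_ord.
apply/row_subP => i; apply: (@gs_rows_span _ _ _ _ xs [::]).
  move=> q /(nthP 0) [j]; rewrite sz => jm <-.
  have -> : nth 0 (gs_rows xs [::]).1 j = row (Ordinal jm) (lq_factor X).1.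
    by apply/rowP => a; rewrite !mxE.
  exact: row_sub.
by apply/mapP; exists i => //; rewrite mem_enum.
Qed.

Lemma lq_factor_unit (R : realType) (m n : nat) (X : 'M[R]_(m, n)) :
  \rank X = m -> exists2 L : 'M[R]_m, L \in unitmx & X = L *m (lq_factor X).1.
Proof.
move=> rX; have /submxP [L XL] := lq_factor_span X; exists L => //.
rewrite -row_full_unit /row_full eqn_leq rank_leq_row /= -[X in (X <= _)%N]rX.
by rewrite {1}XL mxrankM_maxl.
Qed.

Lemma lq_factor_cost (R : realType) (m n : nat) (X : 'M[R]_(m, n)) :
  (0 < m)%N -> (m <= n)%N -> ((lq_factor X).2 <= 8 * (n * m ^ 2))%N.
Proof.
move=> m0 mn; rewrite /lq_factor cbind2 addn0.
apply: leq_trans (gs_rows_cost _ _) _.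
rewrite size_map size_enum_ord addn0 !expnS expn0.
(* The cost is at most 4 n m^2 + 3 n m + m, and 4 + 3 + 1 = 8. *)
have : (n * m <= n * m * m)%N by nia.
nia.
Qed.

(** The row space of [V] meets the kernel of [V^T] trivially, as u u^T = 0 forces u = 0, and their
    dimensions add up to m. *)
Lemma orth_decomp (R : realFieldType) (p m : nat) (V : 'M[R]_(p, m))
    (x : 'rV[R]_m) :
  exists y z, [/\ x = z + y, (y <= V)%MS & z *m V^T = 0].
Proof.
have cap0 : (V :&: kermx V^T)%MS = 0.
  apply/eqP; rewrite -submx0; apply/rV_subP => u.
  rewrite sub_capmx => /andP [/submxP [a ua] /sub_kermxP uV].
  rewrite (@mulmx_tr_eq0 _ _ _ u) ?sub0mx //.
  by rewrite {2}ua trmx_mul mulmxA uV mul0mx.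
have full : \rank (V + kermx V^T)%MS = m.
  by rewrite mxrank_disjoint_sum // mxrank_ker mxrank_tr subnKC // rank_leq_col.
have : (x <= V + kermx V^T)%MS.
  by apply: submx_full; rewrite /row_full full.
case/sub_addsmxP => [[a b]] /= ->.
exists (a *m V), (b *m kermx V^T); rewrite addrC; split=> //.
  exact: submxMl.
by rewrite -mulmxA mulmx_ker mulmx0.
Qed.

(** The columns are transposed because subspaces are row spaces. *)
Definition col_span (R : fieldType) (m n : nat) (X : 'M[R]_(m, n))
    (I : {set 'I_n}) : 'M[R]_m := (\sum_(i in I) <<(col i X)^T>>)%MS.

Lemma col_span_sub (R : fieldType) (m n : nat) (X : 'M[R]_(m, n))
    (I : {set 'I_n}) (i : 'I_n) : i \in I -> ((col i X)^T <= col_span X I)%MS.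
Proof. by move=> iI; rewrite (sumsmx_sup i) // genmxE. Qed.

Lemma col_spanP (R : fieldType) (m n : nat) (X : 'M[R]_(m, n))
    (I : {set 'I_n}) (y : 'rV[R]_m) : (y <= col_span X I)%MS ->
  exists a : 'I_n -> R, y^T = \sum_(i in I) a i *: col i X.
Proof.
case/sub_sumsmxP => u ->; rewrite linear_sum /=.
have /fin_all_exists [a ua] :
  forall i, exists b : R, u i *m <<(col i X)^T>>%MS = b *: (col i X)^T.
  by move=> i; apply/sub_rVP; rewrite -(genmxE (col i X)^T) submxMl.
by exists a; apply: eq_bigr => i _; rewrite ua linearZ /= trmxK.
Qed.

Lemma orth_component_exists (R : realType) (m n : nat) (X : 'M[R]_(m, n))
    (I : {set 'I_n}) (x : 'cV[R]_m) : exists z, orth_component X I x z.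
Proof.
have [y [z [xE yV zV]]] := orth_decomp (col_span X I) x^T.
exists z^T; split=> [i iI|].
  have /submxP [a ->] := col_span_sub X iI.
  by rewrite -mulmxA -[col_span X I]trmxK -trmx_mul zV trmx0 mulmx0.
have [a aE] := col_spanP yV; exists a.
by rewrite -aE -linearD /= -xE trmxK.
Qed.

(** If x lies in the span, so does z, which is also orthogonal to the span, so z^T z = 0. *)
Lemma orth_component0 (R : realType) (m n : nat) (X : 'M[R]_(m, n))
    (I : {set 'I_n}) (x z : 'cV[R]_m) : orth_component X I x z ->
  (z == 0) = (x^T <= col_span X I)%MS.
Proof.
case=> zI [a xE].
have sV : ((\sum_(i in I) a i *: col i X)^T <= col_span X I)%MS.
  rewrite linear_sum /= summx_sub // => i iI; rewrite linearZ /=.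
  by rewrite scalemx_sub // col_span_sub.
apply/eqP/idP => [z0|xV]; first by rewrite xE z0 add0r.
have : (z^T <= col_span X I)%MS.
  have -> : z = x - \sum_(i in I) a i *: col i X by rewrite xE addrK.
  by rewrite linearB /= addmx_sub // eqmx_opp.
case/col_spanP => b; rewrite trmxK => zE.
suff : z^T *m z^T^T = 0 by move/mulmx_tr_eq0/(congr1 trmx); rewrite trmxK trmx0.
rewrite trmxK {1}zE linear_sum /= mulmx_suml big1 // => i iI.
by rewrite linearZ /= -scalemxAl zI // scaler0.
Qed.

Lemma enorm_eq0 (R : realType) (m : nat) (z : 'cV[R]_m) :
  (enorm z == 0) = (z == 0).
Proof.
rewrite /enorm sqrtr_eq0; apply/idP/eqP => [le0|->]; last first.
  by rewrite big1 // => i _; rewrite mxE expr0n.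
apply/matrixP => i j; rewrite ord1 mxE; apply/eqP.
rewrite -sqrf_eq0 eq_le sqr_ge0 andbT; apply: le_trans le0.
by rewrite (bigD1 i) //= lerDl sumr_ge0 // => a _; rewrite sqr_ge0.
Qed.

(** While the span is not full, some column has a nonzero orthogonal component; the selected column
    has one at least as long, so the rank grows. *)
Lemma cpqr_rank (R : realType) (m n : nat) (X : 'M[R]_(m, n)) (t : nat)
    (I : {set 'I_n}) : \rank X = m -> cpqr X t I -> (t <= m)%N ->
  (t <= \rank (col_span X I))%N.
Proof.
move=> rX; elim=> // {}t {}I s zs _ IH sI os smax tm.
have sub : (col_span X I <= col_span X (s |: I))%MS.
  by apply/sumsmx_subP => i iI; rewrite genmxE col_span_sub // inE iI orbT.
have [lt|gt] := ltnP t (\rank (col_span X I)).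
  exact: leq_trans lt (mxrankS sub).
apply: leq_ltn_trans (IH (ltnW tm)) _.
(* If every column lay in the span, then m = \rank X would be at most the rank of the span, hence at
   most t < m. *)
have [j jV] : exists j, ~~ ((col j X)^T <= col_span X I)%MS.
  apply/existsP; apply: contraLR (leqnn m) => /existsPn h; rewrite -ltnNge.
  apply: leq_ltn_trans (leq_ltn_trans gt tm); rewrite -{1}rX -mxrank_tr.
  apply: mxrankS; apply/row_subP => i; rewrite -tr_col.
  by have := h i; rewrite negbK.
have jI : j \notin I by apply: contra jV; apply: col_span_sub.
have [z oz] := orth_component_exists X I (col j X).
have z0 : 0 < enorm z.
  by rewrite lt0r sqrtr_ge0 andbT enorm_eq0 (orth_component0 oz).
have : (col_span X I < col_span X (s |: I))%MS.
  rewrite /ltmx sub /=; apply: contraL (lt_le_trans z0 (smax _ _ jI oz)) => h.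
  rewrite -leNgt le_eqVlt; apply/orP; left; rewrite enorm_eq0.
  by rewrite (orth_component0 os) (submx_trans (col_span_sub X _) h) // setU11.
by rewrite ltmxErank => /andP [].
Qed.

Lemma cpqr_gram_unit (R : realType) (m n : nat) (X : 'M[R]_(m, n))
    (I : {set 'I_n}) : \rank X = m -> cpqr X m I -> gram X I \in unitmx.
Proof.
move=> rX /(cpqr_rank rX) /(_ (leqnn m)) rV.
apply/posdef_unit/gram_posdef => u uI.
have /submxP [D Du] : (u <= col_span X I)%MS.
  by apply: submx_full; rewrite /row_full eqn_leq rank_leq_col.
have : (col_span X I <= kermx u^T)%MS.
  apply/sumsmx_subP => i iI; rewrite genmxE; apply/sub_kermxP.
  by rewrite -trmx_mul uI // trmx0.
move=> /sub_kermxP Vu; apply: mulmx_tr_eq0.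
by rewrite {1}Du -mulmxA Vu mulmx0.
Qed.

(** * The swap loops *)

Lemma run_ex (A : Type) (x : counted A) : exists a t, run x a t.
Proof. by exists x.1, x.2. Qed.

(** [halts_within] also requires that some execution exists, so that its bound is not vacuous. *)
Lemma bind_ex (A B : Type) (p : program A) (f : A -> program B) :
  (exists a t, p a t) -> (forall a, exists b t, f a b t) ->
  exists b t, bind p f b t.
Proof.
move=> [a [t1 pa]] ex; have [b [t2 fb]] := ex a.
by exists b, (t1 + t2)%N, a, t1, t2; split.
Qed.

(** The index i of [Inv] bounds the number of swaps still possible. The fuel is i.+1 because the
    last round only stops; at i = 0 the step hypothesis excludes another swap, as 0 is no
    successor. *)
Lemma loop_halts (St A : Type) (body : St -> program (St + A))
    (Inv : nat -> St -> Prop) (B : nat) :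
  (forall i st, Inv i st -> exists x t, body st x t) ->
  (forall i st x t, Inv i st -> body st x t -> (t <= B)%N /\
     forall st', x = inl st' -> exists2 i', i = i'.+1 & Inv i' st') ->
  forall i st, Inv i st ->
    (exists o t, loop body i.+1 st o t) /\
    forall o t, loop body i.+1 st o t -> o <> None /\ (t <= i.+1 * B)%N.
Proof.
move=> ex step; elim=> [|i IH] st inv; (split=> [|o t [x [t1 [t2 [b h ->]]]]];
    last have [t1B next] := step _ _ _ _ inv b).
- have [x [t b]] := ex _ _ inv; have [_ next] := step _ _ _ _ inv b.
  case: x b next => [st'|a] b next; first by have [i'] := next _ (erefl _).
  by exists (Some a), (t + 0)%N, (inr a), t, 0%N; split.
- case: x b h next => [st'|a] b h next; first by have [i'] := next _ (erefl _).
  by case: h => -> ->; rewrite addn0 mul1n.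
- have [x [t b]] := ex _ _ inv; have [_ next] := step _ _ _ _ inv b.
  case: x b next => [st'|a] b next.
    have [i' [<-] inv'] := next _ (erefl _).
    have [[o [t' l]] _] := IH _ inv'.
    by exists o, (t + t')%N, (inl st'), t, t'; split.
  by exists (Some a), (t + 0)%N, (inr a), t, 0%N; split.
- case: x b h next => [st'|a] b h next.
    have [i' [<-] inv'] := next _ (erefl _).
    have [_ /(_ _ _ h) [oN t2B]] := IH _ inv'.
    by split=> //; rewrite mulSn leq_add.
  case: h => -> ->; split=> //; rewrite addn0 mulSn.
  by apply: leq_trans t1B _; rewrite leq_addr.
Qed.

Lemma loop_post (St A : Type) (body : St -> program (St + A))
    (Inv : St -> Prop) (Post : A -> Prop) :
  (forall st x t, Inv st -> body st x t ->
     match x with inl st' => Inv st' | inr a => Post a end) ->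
  forall N st a t, Inv st -> loop body N st (Some a) t -> Post a.
Proof.
move=> step; elim=> [|N IH] st a t inv; first by case.
case=> [[st'|a'] [t1 [t2 [b + _]]]]; have := step _ _ _ inv b.
  by move=> /IH; apply.
by move=> pa' [[->]].
Qed.

Lemma argmax_exists (R : realType) (I : finType) (A : {set I})
    (f : {ffun I -> R}) : A != set0 -> exists s t, argmax A f s t.
Proof.
case/set0Pn => i0 i0A; case: (@arg_maxP _ _ _ i0 (mem A) f i0A) => s sA smax.
by exists s, #|A|; split.
Qed.

Lemma argmin_exists (R : realType) (I : finType) (A : {set I})
    (f : {ffun I -> R}) : A != set0 -> exists r t, argmin A f r t.
Proof.
case/set0Pn => i0 i0A; case: (@arg_minP _ _ _ i0 (mem A) f i0A) => s sA smin.
by exists s, #|A|; split.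
Qed.

Lemma card_swap (n : nat) (S : {set 'I_n}) (s r : 'I_n) :
  s \notin S -> r \in S -> #|swap S s r| = #|S|.
Proof.
move=> sS rS; apply/eqP; rewrite -(eqn_add2l 1).
have := cardsD1 r (s |: S); rewrite inE rS orbT /= => <-.
by rewrite cardsU1 sS.
Qed.

Lemma det_gram_swap (R : realFieldType) (m n : nat) (X : 'M[R]_(m, n))
    (S : {set 'I_n}) (s r : 'I_n) : gram X S \in unitmx ->
  s \notin S -> r \in S ->
  \det (gram X (swap S s r)) =
  \det (gram X S) * ((1 + lev X S s s) * (1 - lev X (s |: S) r r)).
Proof.
move=> uG sS rS; rewrite /swap det_gramD1 ?inE ?rS ?orbT //.
  by rewrite det_gramU1 // mulrA.
exact: gram_unit_sub (subsetUr _ _) uG.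
Qed.

(** The left side is the gain tested by Dominant-split, the right side the one tabulated by
    Dominant. *)
Lemma swap_gainE (R : realFieldType) (m n : nat) (X : 'M[R]_(m, n))
    (S : {set 'I_n}) (s r : 'I_n) : gram X S \in unitmx -> s \notin S ->
  (1 + lev X S s s) * (1 - lev X (s |: S) r r) =
  (1 + lev X S s s) * (1 - lev X S r r) + lev X S r s * lev X S r s.
Proof.
move=> uG sS; rewrite levU1 // [lev X S s r]lev_sym.
have d0 : 1 + lev X S s s != 0 by rewrite gt_eqF // ltr_pwDl // lev_ge0.
by field.
Qed.

(** A gain above c^2 >= 0 is positive, and so is its first factor; this justifies the division by 1
    - l'_r in the swap that follows. *)
Lemma swap_lev_lt1 (R : realFieldType) (m n : nat) (X : 'M[R]_(m, n))
    (S : {set 'I_n}) (s r : 'I_n) (c : R) : gram X S \in unitmx ->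
  c * c < (1 + lev X S s s) * (1 - lev X (s |: S) r r) ->
  lev X (s |: S) r r < 1.
Proof.
move=> uG /(le_lt_trans _) => /(_ 0); rewrite -expr2 sqr_ge0 => /(_ isT).
by rewrite pmulr_rgt0 ?subr_gt0 // ltr_pwDl // lev_ge0.
Qed.

Lemma gram_unit_swap (R : realFieldType) (m n : nat) (X : 'M[R]_(m, n))
    (S : {set 'I_n}) (s r : 'I_n) : gram X S \in unitmx ->
  r \in S -> lev X (s |: S) r r < 1 -> gram X (swap S s r) \in unitmx.
Proof.
move=> uG rS l1; apply: gram_unitD1 => //; last by rewrite inE rS orbT.
exact: gram_unit_sub (subsetUr _ _) uG.
Qed.

(** The optimality of [s] and [r] is recorded along with the final test: one extends a bound on l_s
    to all columns outside, the other compares l'_r with an average. *)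
Definition split_stop (R : realFieldType) (m n : nat) (X : 'M[R]_(m, n)) (c : R)
    (S : {set 'I_n}) : Prop :=
  S = setT \/ exists s r,
    [/\ s \notin S, r \in S,
        forall j, j \notin S -> lev X S j j <= lev X S s s,
        forall j, j \in S -> lev X (s |: S) r r <= lev X (s |: S) j j &
        (1 + lev X S s s) * (1 - lev X (s |: S) r r) <= c * c].

Lemma dominant_split_step (R : realType) (m n : nat) (X : 'M[R]_(m, n))
    (c : R) (S : {set 'I_n}) x t : gram X S \in unitmx ->
  dominant_split_body X c (S, exact_scores X S) x t ->
  match x with
  | inl st => [/\ st = (st.1, exact_scores X st.1), gram X st.1 \in unitmx,
      #|st.1| = #|S| & c * c * \det (gram X S) < \det (gram X st.1)]
  | inr S' => S' = S /\ split_stop X c S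
  end.
Proof.
move=> uG; rewrite /dominant_split_body /=; case: ifP => [/eqP S0 [-> _]|_].
  by split=> //; left; rewrite -[S]setCK S0 setC0.
case=> s [ts [? [[sS smax _] + _]]]; rewrite inE in sS.
case=> _ [? [? [[-> _] + _]]]; rewrite add_column_val //.
case=> r [tr [? [[rS rmin _] + _]]].
case=> _ [? [? [[-> _] + _]]] => /=; rewrite !ffunE.
case: ifP => [le [-> _]|/negbT]; last rewrite -ltNge => lt.
  split=> //; right; exists s, r; split=> // [j jS|j jS].
    by have := smax j; rewrite inE !ffunE; apply.
  by have := rmin _ jS; rewrite !ffunE.
have uGs := gram_unit_sub (subsetUr [set s] S) uG.
have l1 := swap_lev_lt1 uG lt.
have rsS : r \in s |: S by rewrite inE rS orbT.
case=> _ [? [? [[-> _] [-> _] _]]]; rewrite remove_column_val //.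
split=> //; [exact: gram_unit_swap | exact: card_swap |].
by rewrite det_gram_swap // mulrC ltr_pM2l // det_gram_gt0.
Qed.

Lemma dominant_split_body_cost (R : realType) (m n : nat) (X : 'M[R]_(m, n))
    (c : R) st x t : (0 < m)%N -> (m <= n)%N ->
  dominant_split_body X c st x t -> (t <= 33 * (n * m))%N.
Proof.
move=> m0 mn; case: st => S Yl; rewrite /dominant_split_body /=.
case: ifP => [_ [_ ->] //|_].
have mn' : (0 < m <= n)%N by rewrite m0.
have kn : (#|S| <= n)%N by rewrite -[leqRHS]card_ord max_card.
have k'n : (#|~: S| <= n)%N by rewrite -[leqRHS]card_ord max_card.
(* Two updates of 13 n m each, two scans of at most n and 5 operations for the test: 26 + 2 + 5 =
   33. *)
have nm : (n <= n * m)%N by rewrite leq_pmulr.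
case=> s [_ [t1 [[_ _ ->] + ->]]].
case=> _ [_ [t2 [[-> ->] + ->]]]; have := add_column_cost X s Yl mn'.
move: (add_column X s Yl) => Yl' cA.
case=> r [_ [t3 [[_ _ ->] + ->]]].
case=> _ [_ [t4 [[-> ->] + ->]]] => /=.
case: ifP => _; first case=> _ -> /=.
  by move: #|S| #|~: S| kn k'n => k k' kn k'n; nia.
case=> _ [_ [t5 [[-> ->] [_ ->] ->]]].
rewrite -[(cret _).2]/0%N; have := remove_column_cost X r Yl'.1 mn'.
by move: #|S| #|~: S| kn k'n => k k' kn k'n; nia.
Qed.

Lemma dominant_split_body_ex (R : realType) (m n : nat) (X : 'M[R]_(m, n))
    (c : R) (st : {set 'I_n} * ('M[R]_m * {ffun 'I_n -> R})) :
  st.1 != set0 -> exists x t, dominant_split_body X c st x t.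
Proof.
case: st => S Yl /= S0; rewrite /dominant_split_body /=.
case: ifP => [_|/negbT C0]; first by exists (inr S), 0%N.
apply: bind_ex => [|s]; first exact: argmax_exists.
apply: bind_ex => [|Yl']; first exact: run_ex.
apply: bind_ex => [|r]; first exact: argmin_exists.
apply: bind_ex => [|stop]; first exact: run_ex.
case: stop; first exact: run_ex.
by apply: bind_ex => [|Yl'']; apply: run_ex.
Qed.

Lemma dominant_step (R : realType) (m n : nat) (X : 'M[R]_(m, n))
    (c : R) (S : {set 'I_n}) x t : gram X S \in unitmx ->
  dominant_body c (S, exact_swap_scores X S) x t ->
  match x with
  | inl st => exists s r,
      [/\ s \notin S, r \in S,
          st = (swap S s r, exact_swap_scores X (swap S s r)),
          gram X (swap S s r) \in unitmx &
          c * c * \det (gram X S) < \det (gram X (swap S s r)) /\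
          forall s' r', s' \notin S -> r' \in S ->
          \det (gram X (swap S s' r')) <= \det (gram X (swap S s r))]
  | inr S' => S' = S /\ forall s r, s \notin S -> r \in S ->
      \det (gram X (swap S s r)) <= c * c * \det (gram X S)
  end.
Proof.
move=> uG; rewrite /dominant_body /=; case: ifP => [/eqP S0 [-> _]|_].
  by split=> // s r; rewrite -in_setC S0 inE.
case=> _ [? [? [[-> _] + _]]]; set f := (tabulate _ _).1.
(* Up to the factor det G_S > 0 the table holds the determinants after each swap, so its largest
   entry is a swap of largest volume. *)
have fE s r : s \notin S -> r \in S -> \det (gram X S) * f (r, s) =
    \det (gram X (swap S s r)).
  move=> sS rS; rewrite det_gram_swap // swap_gainE // /f ffunE.
  by rewrite in_setX rS inE sS /= !ffunE /= rS.
have fE' s r : s \notin S -> r \in S -> f (r, s) =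
    (1 + lev X S s s) * (1 - lev X (s |: S) r r).
  move=> sS rS; apply: (mulfI (lt0r_neq0 (det_gram_gt0 uG))).
  by rewrite fE // det_gram_swap.
have d0 := det_gram_gt0 uG; clearbody f.
case=> -[r s] [? [? [[+ fmax _] + _]]]; rewrite in_setX inE => /andP [rS sS].
have {}fmax s' r' : s' \notin S -> r' \in S -> f (r', s') <= f (r, s).
  by move=> s'S r'S; apply: fmax; rewrite in_setX inE r'S.
case=> _ [? [? [[-> _] + _]]]; rewrite [(_ <= _)%cnt.1]/=.
case: ifP => [le [-> _]|/negbT]; last rewrite -ltNge => lt.
  split=> // s' r' s'S r'S; rewrite -fE // mulrC ler_pM2r //.
  exact: le_trans (fmax _ _ s'S r'S) le.
have l1 : lev X (s |: S) r r < 1.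
  by apply: (swap_lev_lt1 uG (c := c)); rewrite -fE'.
case=> _ [? [? [[-> _] [-> _] _]]]; exists s, r; split=> //.
- by rewrite update_swap_scores_val.
- exact: gram_unit_swap.
split=> [|s' r' s'S r'S]; first by rewrite -fE // mulrC ltr_pM2l.
by rewrite -!fE // ler_pM2l // fmax.
Qed.

Lemma dominant_body_cost (R : realType) (n : nat) (c : R)
    (st : {set 'I_n} * ({ffun 'I_n -> R} * {ffun 'I_n * 'I_n -> R})) x t :
  dominant_body c st x t -> (t <= 28 * (n * #|st.1|))%N.
Proof.
case: st => S lC; rewrite /dominant_body /=; case: ifP => [_ [_ ->] //|_].
case=> _ [_ [t1 [[-> ->] + ->]]]; rewrite (tabulate_cost _ (d := 5)) //.
case=> rs [_ [t2 [[rsS _ ->] + ->]]].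
have rS : rs.1 \in S by move: rsS; rewrite inE => /andP [].
have n0 : (0 < n)%N by exact: leq_ltn_trans (leq0n _) (ltn_ord rs.1).
have S0 : (0 < #|S|)%N by apply/card_gt0P; exists rs.1.
have : (#|~: S| <= n)%N by rewrite -[leqRHS]card_ord max_card.
rewrite cardsX => k'n.
(* 28 = 5 + 1 + 2 + 20: the table, the scan of its entries, the test and the update. *)
have h1 : (#|S| * #|~: S| <= n * #|S|)%N by rewrite mulnC leq_mul2r k'n orbT.
have h2 : (1 <= n * #|S|)%N by rewrite muln_gt0 n0.
case=> _ [_ [t3 [[-> ->] + ->]]] => /=.
case: ifP => _; first case=> _ -> /=.
  by move: #|S| #|~: S| S0 h1 h2 k'n => k k' S0 h1 h2 k'n; nia.
case=> _ [_ [t4 [[-> ->] [_ ->] ->]]].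
rewrite -[(cret _).2]/0%N; have := update_swap_scores_cost rs.2 lC rS.
by move: #|S| #|~: S| S0 h1 h2 k'n => k k' S0 h1 h2 k'n; nia.
Qed.

Lemma dominant_body_ex (R : realType) (n : nat) (c : R)
    (st : {set 'I_n} * ({ffun 'I_n -> R} * {ffun 'I_n * 'I_n -> R})) :
  st.1 != set0 -> exists x t, dominant_body c st x t.
Proof.
case: st => S lC /= S0; rewrite /dominant_body /=.
case: ifP => [_|/negbT C0]; first by exists (inr S), 0%N.
apply: bind_ex => [|f]; first exact: run_ex.
apply: bind_ex => [|rs].
  apply: argmax_exists; case/set0Pn: S0 => r rS; case/set0Pn: C0 => s sS.
  by apply/set0Pn; exists (r, s); rewrite in_setX rS.
apply: bind_ex => [|stop]; first exact: run_ex.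
case: stop; first exact: run_ex.
by apply: bind_ex => [|lC']; apply: run_ex.
Qed.

(** * Quality of the initialization *)

(** With l = l_s, the new score of s is l / (1 + l), so averaging gives (2m-1) l'_r <= m - l / (1 +
    l). Inserted into (2m-1) (1 + l) (1 - l'_r) <= 4m - 1, this leaves m l <= 3 m. *)
Lemma split_stop_lev (R : realFieldType) (m n : nat) (X : 'M[R]_(m, n)) (c : R)
    (S : {set 'I_n}) : (0 < m)%N -> gram X S \in unitmx ->
  #|S| = minn (2 * m - 1) n -> c * c <= 1 + (2 * m)%:R / (2 * m - 1)%:R ->
  split_stop X c S -> forall j, lev X S j j <= 3.
Proof.
move=> m0 uG cS cc stop j.
have [jS|jS] := boolP (j \in S).
  by apply: le_trans (lev_le1 uG jS) _; rewrite ler1n.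
case: stop => [S1|[s [r [sS rS smax rmin le]]]]; first by rewrite S1 inE in jS.
apply: le_trans (smax _ jS) _.
(* As s lies outside [S], the cap by n is not the one attained. *)
have cS' : #|S| = (2 * m - 1)%N.
  have : (#|S| < n)%N.
    rewrite -[X in (_ < X)%N]card_ord -cardsT proper_card // properE subsetT.
    by apply/subsetPn; exists s; rewrite ?inE.
  by rewrite cS /minn; case: ifP => // _; rewrite ltnn.
have uGs := gram_unit_sub (subsetUr [set s] S) uG.
have l0 := lev_ge0 s uG.
have sum_le : (2 * m - 1)%:R * lev X (s |: S) r r <=
    m%:R - lev X (s |: S) s s.
  rewrite -(lev_sum uGs) (big_setU1 _ sS) /= addrAC subrr add0r.
  by rewrite -cS' mulrC mulr_natr -sumr_const ler_sum.
move: sum_le le; rewrite [lev X (s |: S) s s]levU1 //.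
set l := lev X S s s in l0 *; set l' := lev X _ r r => sum_le le.
have mE : (2 * m - 1)%:R = 2 * m%:R - 1 :> R.
  by rewrite natrB ?natrM // muln_gt0.
have m1 : 1 <= m%:R :> R by rewrite ler1n.
rewrite natrM mE in cc sum_le.
have d0 : 0 < 1 + l by rewrite ltr_pwDl.
have p0 : 0 < 2 * m%:R - 1 :> R by lra.
have h1 : (2 * m%:R - 1) * (c * c) <= 2 * m%:R - 1 + 2 * m%:R.
  rewrite -(ler_pM2l p0) in cc; apply: le_trans cc _.
  by rewrite mulrDr mulr1 [_ / _]mulrC mulVKf // gt_eqF.
have h2 : (1 + l) * ((2 * m%:R - 1) * l') <= (1 + l) * m%:R - l.
  rewrite -(ler_pM2l d0) in sum_le; apply: le_trans sum_le _.
  rewrite le_eqVlt; apply/orP; left; apply/eqP; field.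
  by rewrite gt_eqF.
rewrite -(ler_pM2l p0) in le.
have h3 : m%:R * l <= m%:R * 3 by lra.
by rewrite -(ler_pM2l (_ : 0 < m%:R)) // ltr0n.
Qed.

Lemma gram_unit_mull (R : comUnitRingType) (m n : nat) (L : 'M[R]_m)
    (X : 'M[R]_(m, n)) (S : {set 'I_n}) : L \in unitmx ->
  (gram (L *m X) S \in unitmx) = (gram X S \in unitmx).
Proof. by move=> uL; rewrite gram_mull !unitmx_mul unitmx_tr uL /= andbT. Qed.

Lemma det_gram_mull (R : comPzRingType) (m n : nat) (L : 'M[R]_m)
    (X : 'M[R]_(m, n)) (S : {set 'I_n}) :
  \det (gram (L *m X) S) = \det L ^+ 2 * \det (gram X S).
Proof. by rewrite gram_mull !det_mulmx det_tr; ring. Qed.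

(** The inverse Gram matrix turns into L^-T G_S^-1 L^-1, and the outer factors cancel. Hence the LQ
    step leaves the scores unchanged. *)
Lemma lev_mull (R : comUnitRingType) (m n : nat) (L : 'M[R]_m)
    (X : 'M[R]_(m, n)) (S : {set 'I_n}) (i j : 'I_n) : L \in unitmx ->
  gram X S \in unitmx -> lev (L *m X) S i j = lev X S i j.
Proof.
move=> uL uG; rewrite /lev.
have uLG : gram (L *m X) S \in unitmx by rewrite gram_unit_mull.
suff -> : invmx (gram (L *m X) S) =
    (invmx L)^T *m invmx (gram X S) *m invmx L.
  rewrite !col_mulmx trmx_mul !mulmxA -[(col i X)^T *m L^T *m _]mulmxA.
  by rewrite -trmx_mul mulVmx // trmx1 mulmx1 mulmxKV.
rewrite -[LHS]mulmx1; apply: (canLR (mulKmx uLG)).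
rewrite gram_mull !mulmxA -[L *m _ *m L^T *m _]mulmxA -trmx_mul mulVmx //.
by rewrite trmx1 mulmx1 mulmxK // mulmxV.
Qed.

(** The stopping condition is about [X'], the matrix on which the loop has run, which is either [X]
    or its LQ factor. *)
Lemma dominant_split_post (R : realType) (m n : nat) (lq : bool)
    (X : 'M[R]_(m, n)) (S S' : {set 'I_n}) (c : R) : \rank X = m ->
  gram X S \in unitmx -> outputs (dominant_split lq X S c) S' ->
  [/\ gram X S' \in unitmx, #|S'| = #|S| &
      exists L X', [/\ L \in unitmx, X = L *m X' & split_stop X' c S']].
Proof.
move=> rX uG [N [t]]; rewrite /dominant_split.
case=> X' [? [? [[-> _] + _]]].
have [L uL XL] : exists2 L : 'M_m, L \in unitmx &
    X = L *m (if lq then lq_factor X else cret X).1.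
  case: lq; first exact: lq_factor_unit.
  by exists 1%:M; rewrite ?unitmx1 ?mul1mx.
move: (_.1) XL => {}X' XL.
have uG' : gram X' S \in unitmx by rewrite -(gram_unit_mull _ _ uL) -XL.
case=> _ [? [? [[-> _] + _]]]; rewrite init_scores_val //.
pose Inv (st : {set 'I_n} * ('M[R]_m * {ffun 'I_n -> R})) :=
  [/\ st = (st.1, exact_scores X' st.1), gram X' st.1 \in unitmx &
      #|st.1| = #|S|].
pose Post (T : {set 'I_n}) :=
  [/\ gram X' T \in unitmx, #|T| = #|S| & split_stop X' c T].
move=> /(loop_post (Inv := Inv) (Post := Post)) h.
have [| |u1 u2 u3] := h.
- case=> T Yl x t' [/= -> uT cT] /dominant_split_step -/(_ uT).
  case: x => [st [h1 h2 h3 _]|T' [-> stop]]; last by split.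
  by split=> //; rewrite h3.
- by split.
by split=> //; [rewrite XL gram_unit_mull | exists L, X'].
Qed.

Lemma root_exists (R : realType) (m : nat) (x : R) : (0 < m)%N -> 0 <= x ->
  exists2 y : R, 0 <= y & y ^+ m = x.
Proof.
move=> m0 x0; exists (x `^ (m%:R^-1)); first exact: powR_ge0.
rewrite -powR_mulrn ?powR_ge0 // -powRrM mulVf ?powRr1 //.
by rewrite pnatr_eq0 -lt0n.
Qed.

(** (1 + l / (4 m))^m <= e^(l/4) <= 1 / (1 - l/4) <= 1 + l, the last because (1 - l/4) (1 + l) = 1 +
    l (3 - l) / 4. This is where scores at most 3 are needed, and the origin of the 4. *)
Lemma root_step (R : realType) (m : nat) (l D D1 : R) : (0 < m)%N ->
  0 <= l <= 3 -> 0 <= D -> 0 <= D1 -> D1 ^+ m = D ^+ m * (1 + l) ->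
  D * (1 + l / (4 * m%:R)) <= D1.
Proof.
move=> m0 /andP [l0 l3] D0 D10 DE.
have mR : 0 < m%:R :> R by rewrite ltr0n.
have x0 : 0 <= l / (4 * m%:R) by rewrite divr_ge0 // mulr_ge0 // ltW.
rewrite -(@ler_pXn2r _ m) ?nnegrE //; last first.
  by rewrite mulr_ge0 // addr_ge0.
rewrite exprMn DE ler_wpM2l ?exprn_ge0 //.
apply: (@le_trans _ _ (expR (l / 4))).
  have -> : l / 4 = l / (4 * m%:R) * m%:R by field; rewrite gt_eqF.
  by rewrite expRM_natr lerXn2r ?nnegrE ?expR_ge0 ?addr_ge0 ?expR_ge1Dx.
have h : 1 - l / 4 <= (expR (l / 4))^-1 by rewrite -expRN expR_ge1Dx.
have e0 := expR_gt0 (l / 4).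
have h' : (1 - l / 4) * expR (l / 4) <= 1.
  by rewrite -(ler_pM2r e0) mulVf ?gt_eqF // in h.
have p : 0 < 1 - l / 4 by lra.
rewrite -(ler_pM2l p); apply: le_trans h' _; nra.
Qed.

(** The columns of [T] in [S] contribute at most the full sum m over [S], the others at most l
    each. *)
Lemma sum_lev_le (R : realFieldType) (m n : nat) (X : 'M[R]_(m, n))
    (S T : {set 'I_n}) (l : R) : gram X S \in unitmx -> 0 <= l ->
  (forall j, j \notin S -> lev X S j j <= l) ->
  \sum_(j in T) lev X S j j <= m%:R + #|T|%:R * l.
Proof.
move=> uG l0 le; pose f j := if j \in S then lev X S j j else 0.
apply: (@le_trans _ _ (\sum_(j in T) (f j + l))).
  apply: ler_sum => j _; rewrite /f.
  case: ifPn => [_|/le]; first by rewrite lerDl.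
  by rewrite add0r.
rewrite big_split /= sumr_const mulr_natl lerD2r -(lev_sum uG).
rewrite [leRHS]big_mkcond.
rewrite [leLHS]big_mkcond /=; apply: ler_sum => j _; rewrite /f.
by case: ifP => _ //; case: ifP => // _; apply: lev_ge0.
Qed.

(* [D] and [P] are the m-th roots of the determinants for [S] and [T]: by
   concavity of the m-th root, the largest score [l] satisfies
   P <= D (1 + k l / m), whereas adding its column multiplies [D] by at least
   1 + l / (4 m).  So every step closes a fraction 1 / (4 k) of the gap. *)
Lemma greedy_append_bound (R : realType) (m n : nat) (X : 'M[R]_(m, n))
    (T : {set 'I_n}) (P : R) : (0 < m)%N -> (0 < #|T|)%N -> 0 <= P ->
  P ^+ m = \det (gram X T) ->
  forall t (S S' : {set 'I_n}) (D : R) u, gram X S \in unitmx ->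
  (forall j, lev X S j j <= 3) -> 0 <= D -> D ^+ m = \det (gram X S) ->
  greedy_append X t S (exact_scores X S) S' u ->
  [/\ gram X S' \in unitmx, #|S'| = (#|S| + t)%N &
      exists D', [/\ D <= D', D' ^+ m = \det (gram X S') &
        D + t%:R * ((P - D') / (4 * #|T|%:R)) <= D']].
Proof.
move=> m0 T0 P0 PE; elim=> [|t IH] S S' D u uG l3 D0 DE.
  case=> -> _; split; rewrite ?addn0 //.
  by exists D; split; rewrite ?mul0r ?addr0.
case=> s [? [? [[+ smax _] + _]]]; rewrite inE => sS.
case=> _ [? [? [[-> _] + _]]]; rewrite add_column_val // => h.
have uGs := gram_unit_sub (subsetUr [set s] S) uG.
have ls j : j \notin S -> lev X S j j <= lev X S s s.
  by move=> jS; have := smax j; rewrite inE !ffunE; apply.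
have l0 := lev_ge0 s uG.
have mR : 0 < m%:R :> R by rewrite ltr0n.
have kR : 0 < #|T|%:R :> R by rewrite ltr0n.
have [D1 D10 D1E] := root_exists m0 (det_gram_ge0 X (s |: S)).
have step : D * (1 + lev X S s s / (4 * m%:R)) <= D1.
  by apply: root_step; rewrite ?l0 ?l3 // D1E DE det_gramU1.
have gap : P <= D * (1 + #|T|%:R * lev X S s s / m%:R).
  rewrite -(@ler_pXn2r _ m) ?nnegrE //; last first.
    by rewrite mulr_ge0 // addr_ge0 // divr_ge0 ?mulr_ge0 // ltW.
  rewrite PE exprMn DE; apply: le_trans (det_gram_le T uG) _.
  rewrite ler_wpM2l ?det_gram_ge0 // lerXn2r ?nnegrE //.
  - by rewrite divr_ge0 ?sumr_ge0 // => j _; apply: lev_ge0.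
  - by rewrite addr_ge0 // divr_ge0 ?mulr_ge0 // ltW.
  rewrite ler_pdivrMr // mulrDl mul1r divfK ?gt_eqF //.
  exact: sum_lev_le.
have l3' j : lev X (s |: S) j j <= 3 by apply: le_trans (levU1_le _ _ _) (l3 j).
have [uG' cS' [D' [DD' D'E lb]]] := IH _ _ _ _ uGs l3' D10 D1E h.
split=> //; first by rewrite cS' cardsU1 sS addnS add1n.
have k4 : 0 < 4 * #|T|%:R :> R by rewrite mulr_gt0.
have DD1 : D <= D1.
  apply: le_trans step; rewrite -{1}[D]mulr1 ler_wpM2l // lerDl.
  by rewrite divr_ge0 // mulr_ge0 // ltW.
have gap' : (P - D) / (4 * #|T|%:R) <= D * (lev X S s s / (4 * m%:R)).
  rewrite ler_pdivrMr //.
  have -> : D * (lev X S s s / (4 * m%:R)) * (4 * #|T|%:R) =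
    D * (1 + #|T|%:R * lev X S s s / m%:R) - D by field; rewrite gt_eqF.
  by rewrite lerD2r.
exists D'; split=> //; first exact: le_trans DD'.
(* The roots only increase, so the gap at the end is the smallest; measuring every step by it makes
   the gains of the t steps add up. *)
have gap'' : (P - D') / (4 * #|T|%:R) <= (P - D) / (4 * #|T|%:R).
  by rewrite ler_pM2r ?invr_gt0 // lerD2l lerN2 (le_trans DD1).
apply: le_trans lb; rewrite -natr1 mulrDl mul1r addrCA addrC lerD2r.
apply: le_trans step; rewrite mulrDr mulr1 lerD2l.
exact: le_trans gap'' gap'.
Qed.

(** The smallest score is at most m / #|S|, so a removal keeps at least the fraction 1 - m / #|S| =
    'C(#|S| - 1, m) / 'C(#|S|, m) of the determinant, and these ratios telescope. *)
Lemma greedy_remove_bound (R : realType) (m n : nat) (X : 'M[R]_(m, n)) :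
  (0 < m)%N -> forall t (S S' : {set 'I_n}) u, gram X S \in unitmx ->
  (m + t <= #|S|)%N -> greedy_remove X t S (exact_scores X S) S' u ->
  [/\ gram X S' \in unitmx, (#|S'| + t)%N = #|S| &
      'C(#|S'|, m)%:R * \det (gram X S) <= 'C(#|S|, m)%:R * \det (gram X S')].
Proof.
move=> m0; elim=> [|t IH] S S' u uG mt.
  by case=> -> _; split; rewrite ?addn0.
case=> r [? [? [[rS rmin _] + _]]].
have cS : #|S| = #|S :\ r|.+1 by rewrite (cardsD1 r) rS.
have S0 : 0 < #|S|%:R :> R by rewrite ltr0n cS.
have lr : lev X S r r <= m%:R / #|S|%:R.
  rewrite ler_pdivlMr // mulr_natr -(lev_sum uG) -sumr_const.
  by apply: ler_sum => j jS; have := rmin _ jS; rewrite !ffunE.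
have l1 : lev X S r r < 1.
  apply: le_lt_trans lr _; rewrite ltr_pdivrMr // mul1r ltr_nat.
  by apply: leq_trans mt; rewrite -addn1 leq_add2l.
case=> _ [? [? [[-> _] + _]]]; rewrite remove_column_val // => h.
have mt' : (m + t <= #|S :\ r|)%N by rewrite -ltnS -cS -addnS.
have [uG' cS' le] := IH _ _ _ (gram_unitD1 uG rS l1) mt' h.
split=> //; first by rewrite addnS cS'.
have C0 : 0 < 'C(#|S :\ r|, m)%:R :> R.
  by rewrite ltr0n bin_gt0 (leq_trans _ mt') // leq_addr.
have mS : (m <= #|S|)%N by rewrite (leq_trans _ mt) // leq_addr.
have binE : #|S|%:R * 'C(#|S :\ r|, m)%:R =
    (#|S|%:R - m%:R) * 'C(#|S|, m)%:R :> R.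
  have := mul_bin_down #|S| m; rewrite {2}cS /= => e.
  by rewrite -natrM e natrM natrB.
have step : 'C(#|S :\ r|, m)%:R * \det (gram X S) <=
    'C(#|S|, m)%:R * \det (gram X (S :\ r)).
  rewrite det_gramD1 // mulrCA [leLHS]mulrC ler_pM2l ?det_gram_gt0 //.
  rewrite -(ler_pM2l S0) binE [leRHS]mulrCA [leLHS]mulrC ler_wpM2l //.
  by rewrite mulrBr mulr1 lerD2l lerN2 mulrC -ler_pdivlMr.
rewrite -(ler_pM2l C0) mulrCA [leRHS]mulrCA.
apply: (@le_trans _ _
  ('C(#|S'|, m)%:R * ('C(#|S|, m)%:R * \det (gram X (S :\ r))))).
  by rewrite ler_wpM2l.
by rewrite [leLHS]mulrCA ler_wpM2l.
Qed.

Lemma bin_le_exp2 (n m : nat) : ('C(n, m) <= 2 ^ n)%N.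
Proof.
elim: n m => [|n IH] [|m]; rewrite ?bin0 ?bin0n ?expn_gt0 //.
by rewrite binS expnS mul2n -addnn leq_add.
Qed.

Lemma advanced_init_parameter_sqr (R : realType) (m : nat) :
  advanced_init_parameter R m * advanced_init_parameter R m <=
  1 + (2 * m)%:R / (2 * m - 1)%:R.
Proof.
rewrite -expr2 sqr_sqrtr ?ge_min ?lexx ?orbT //.
by rewrite le_min ltW ?expR_gt0 // addr_ge0 // divr_ge0.
Qed.

(* 24 = 6 * 4: for k <= 2m-1 the trace bound gives (3 k / m)^m <= 6^m, and the
   greedy removals lose a factor at most 'C(2m-1, m) <= 4^m; when columns are
   appended the factor is at most 12^m. *)
Lemma advanced_init_bound (R : realType) (m n k : nat) (X : 'M[R]_(m, n))
    (lq : bool) (S : {set 'I_n}) : (0 < m)%N -> \rank X = m ->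
  (m <= k)%N -> (k <= n)%N -> advanced_init lq X k S ->
  [/\ gram X S \in unitmx, #|S| = k &
      forall T : {set 'I_n}, #|T| = k ->
        \det (gram X T) <= 24 ^+ m * \det (gram X S)].
Proof.
move=> m0 rX mk kn [I [S0 [S1 [cI IS0 cS0 out [t greedy]]]]].
have uS0 := gram_unit_sub IS0 (cpqr_gram_unit rX cI).
have [uS1 cS1 [L [X' [uL XL stop]]]] := dominant_split_post rX uS0 out.
have uS1' : gram X' S1 \in unitmx by rewrite -(gram_unit_mull _ _ uL) -XL.
rewrite cS0 in cS1.
have l3 j : lev X S1 j j <= 3.
  rewrite XL lev_mull //.
  exact: (split_stop_lev m0 uS1' cS1 (advanced_init_parameter_sqr R m) stop).
have mR : 0 < m%:R :> R by rewrite ltr0n.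
have k0 : (0 < k)%N := leq_trans m0 mk.
have detT (T : {set 'I_n}) : #|T| = k ->
    \det (gram X T) <= \det (gram X S1) * (3 * k%:R / m%:R) ^+ m.
  move=> cT; apply: le_trans (det_gram_le T uS1) _.
  have s0 : 0 <= \sum_(j in T) lev X S1 j j.
    by apply: sumr_ge0 => j _; apply: lev_ge0.
  rewrite ler_wpM2l ?det_gram_ge0 // lerXn2r ?nnegrE ?divr_ge0 ?mulr_ge0 //.
  rewrite ler_pM2r ?invr_gt0 // -cT mulr_natr -sumr_const.
  by apply: ler_sum => j _.
rewrite init_scores_val // in greedy.
move: greedy; case: leqP => [kp|pk] greedy.
  have mt : (m + (minn (2 * m - 1) n - k) <= #|S1|)%N.
    by rewrite cS1; clear -mk kp; lia.
  have [uS cS bin] := greedy_remove_bound m0 uS1 mt greedy.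
  have {}cS : #|S| = k by move: cS; rewrite cS1; clear -kp; lia.
  split=> // T /detT le; apply: le_trans le _; rewrite mulrC.
  have d1 : \det (gram X S1) <= 4 ^+ m * \det (gram X S).
    rewrite cS cS1 in bin.
    apply: (@le_trans _ _ ('C(k, m)%:R * \det (gram X S1))).
      by rewrite ler_peMl ?det_gram_ge0 // ler1n bin_gt0.
    apply: le_trans bin _; rewrite ler_wpM2r ?det_gram_ge0 //.
    rewrite -natrX ler_nat; apply: leq_trans (bin_le_exp2 _ _) _.
    rewrite -[4%N]/(2 ^ 2)%N -expnM leq_exp2l //.
    by apply: leq_trans (geq_minl _ _) (leq_subr _ _).
  have h6 : (3 * k%:R / m%:R) ^+ m <= 6 ^+ m :> R.
    rewrite lerXn2r ?nnegrE ?divr_ge0 ?mulr_ge0 // ler_pdivrMr //.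
    by rewrite -!natrM ler_nat; clear -kp; lia.
  apply: le_trans (ler_pM _ _ h6 d1) _; rewrite ?det_gram_ge0 //.
    by rewrite exprn_ge0 // divr_ge0 ?mulr_ge0.
  by rewrite mulrA -exprMn -natrM.
have pE : minn (2 * m - 1) n = (2 * m - 1)%N by clear -pk kn; lia.
rewrite pE in cS1 pk greedy.
have [D0 D00 D0E] := root_exists m0 (det_gram_ge0 X S1).
have append (T : {set 'I_n}) P : #|T| = k -> 0 <= P ->
    P ^+ m = \det (gram X T) -> _ := fun cT P0 PE =>
  greedy_append_bound m0 (leq_trans k0 (eq_leq (esym cT))) P0 PE uS1 l3 D00 D0E
    greedy.
(* Any competitor will do here: it is used to extract the facts on [S] that do not depend on the
   competitor. *)
have [T1 cT1] : exists T : {set 'I_n}, #|T| = k.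
  exists [set x in take k (enum 'I_n)]; rewrite cardsE.
  rewrite (card_uniqP _) ?take_uniq ?enum_uniq // size_takel //.
  by rewrite size_enum_ord.
have [P0 P0ge0 P0E] := root_exists m0 (det_gram_ge0 X T1).
have [uS cS _] := append T1 P0 cT1 P0ge0 P0E.
split=> // [|T cT]; first by rewrite cS cS1; clear -pk; lia.
have [P Pge0 PE] := root_exists m0 (det_gram_ge0 X T).
have [_ _ [D [D0D DE lb]]] := append T P cT Pge0 PE.
have Dge0 : 0 <= D by apply: le_trans D0D.
rewrite -PE -DE -exprMn lerXn2r ?nnegrE ?mulr_ge0 //.
have kR : 0 < k%:R :> R by rewrite ltr0n.
(* For k < 4m the trace bound gives 3 k / m < 12. For k >= 4m more than half of the columns were
   appended, so an eighth of the final gap is at most D, and P <= 9 D. *)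
have [k4|k4] := ltnP k (4 * m).
  apply: (@le_trans _ _ (D0 * (3 * k%:R / m%:R))).
    rewrite -(@ler_pXn2r _ m) ?nnegrE ?mulr_ge0 ?invr_ge0 //.
    by rewrite PE exprMn D0E detT.
  rewrite [leRHS]mulrC ler_pM ?divr_ge0 ?mulr_ge0 //.
  by rewrite ler_pdivrMr // -!natrM ler_nat; clear -k4; lia.
have [PD|DP] := leP P D; first by clear -PD Dge0; lra.
have th : 8^-1 <= (k - (2 * m - 1))%:R / (4 * k%:R) :> R.
  rewrite ler_pdivlMr ?mulr_gt0 // mulrA.
  have -> : 8^-1 * 4 * k%:R = k%:R / 2 :> R by field.
  by rewrite ler_pdivrMr // -natrM ler_nat; clear -k4; lia.
have : (P - D) / 8 <= D.
  apply: le_trans lb; rewrite cT mulrCA; apply: (@le_trans _ _ (0 + (P - D) *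
    ((k - (2 * m - 1))%:R / (4 * k%:R)))); last by rewrite lerD2r.
  by rewrite add0r ler_wpM2l // subr_ge0 ltW.
by clear -Dge0; lra.
Qed.

(** * Termination *)

(** 24 <= 2^5 <= e^5, so more than 5 m / min(1, ln c) factors c, and a fortiori c^2, exceed 24^m.
    Rounding up turns 5 into 6, because m / min(1, ln c) >= 1. *)
Lemma rounds_exist (R : realType) (m : nat) (c : R) : (0 < m)%N -> 1 < c ->
  exists i, 24 ^+ m < (c * c) ^+ i.+1 /\
            i.+1%:R <= 6 * (m%:R / Num.min 1 (ln c)).
Proof.
move=> m0 c1; have lc0 : 0 < ln c by rewrite ln_gt0.
set lc := Num.min 1 (ln c).
have l0 : 0 < lc by rewrite lt_min ltr01.
have l1 : lc <= 1 by rewrite ge_min lexx.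
have l2 : lc <= ln c by rewrite ge_min lexx orbT.
have mR : 1 <= m%:R :> R by rewrite ler1n.
have ml : 1 <= m%:R / lc by rewrite ler_pdivlMr // mul1r (le_trans l1).
have x0 : 0 <= 5 * (m%:R / lc) by rewrite mulr_ge0 // (le_trans ler01).
exists (Num.truncn (5 * (m%:R / lc))); split; last first.
  have := truncn_le (5 * (m%:R / lc)); rewrite x0 -natr1 => h; lra.
have := truncnS_gt (5 * (m%:R / lc)); set i := (Num.truncn _).+1 => h.
have c0 : 0 < c by apply: lt_trans c1.
have e24 : 24 <= expR 5 :> R.
  have -> : 5 = 1 * 5%:R :> R by rewrite mul1r.
  rewrite expRM_natr; apply: (@le_trans _ _ (2 ^+ 5)); first by lra.
  by rewrite lerXn2r ?nnegrE ?expR_ge0 //; apply: le_trans (expR_ge1Dx 1); lra.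
apply: (@le_lt_trans _ _ (expR (5 * m%:R))).
  by rewrite expRM_natr lerXn2r ?nnegrE ?expR_ge0.
apply: (@lt_le_trans _ _ (expR (ln c * i%:R))).
  rewrite ltr_expR.
  have : 5 * m%:R < i%:R * lc.
    by move: h; rewrite mulrA ltr_pdivrMr.
  by move=> /lt_le_trans; apply; rewrite mulrC ler_wpM2r.
rewrite expRM_natr lnK ?posrE // lerXn2r ?nnegrE ?mulr_ge0 ?ltW //.
by rewrite ltr_pMr.
Qed.

Lemma dominant_split_halts (R : realType) (m n : nat) (lq : bool)
    (X : 'M[R]_(m, n)) (c : R) (S : {set 'I_n}) : (0 < m)%N -> (m <= n)%N ->
  \rank X = m -> 1 < c -> gram X S \in unitmx ->
  (forall T : {set 'I_n}, #|T| = #|S| ->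
     \det (gram X T) <= 24 ^+ m * \det (gram X S)) ->
  halts_within (dominant_split lq X S c)
    (219 * (n%:R * m%:R ^+ 2 / Num.min 1 (ln c))).
Proof.
move=> m0 mn rX c1 uG opt; have [i [i24 iB]] := rounds_exist m0 c1.
have S0 : (0 < #|S|)%N.
  rewrite lt0n cards_eq0; apply: contraTneq uG => ->.
  by rewrite /gram big_set0 -row_free_unit /row_free mxrank0 ltn_eqF.
have [L uL XL] : exists2 L : 'M_m, L \in unitmx &
    X = L *m (if lq then lq_factor X else cret X).1.
  case: lq; first exact: lq_factor_unit.
  by exists 1%:M; rewrite ?unitmx1 ?mul1mx.
have lqB : ((if lq then lq_factor X else cret X).2 <= 8 * (n * m ^ 2))%N.
  by case: lq XL => // _; apply: lq_factor_cost.
rewrite /halts_within /dominant_split.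
move: (if lq then _ else _) XL lqB => -[X' tq] /= XL lqB.
have uG' : gram X' S \in unitmx by rewrite -(gram_unit_mull _ _ uL) -XL.
have dL : 0 < \det L ^+ 2.
  by rewrite exprn_even_gt0 //= -unitfE -unitmxE.
have opt' (T : {set 'I_n}) : #|T| = #|S| ->
    \det (gram X' T) <= 24 ^+ m * \det (gram X' S).
  by move/opt; rewrite XL !det_gram_mull mulrCA ler_pM2l.
(* Each swap pays for one factor c^2 on the right, so j decreases. A swap at j = 0 would give a
   determinant above 24^m det G_S, against [opt']. *)
pose Inv j (st : {set 'I_n} * ('M[R]_m * {ffun 'I_n -> R})) :=
  [/\ st = (st.1, exact_scores X' st.1), gram X' st.1 \in unitmx,
      #|st.1| = #|S| &
      24 ^+ m * \det (gram X' S) < (c * c) ^+ j.+1 * \det (gram X' st.1)].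
have [|||[o [t l]] all] := @loop_halts _ _ (dominant_split_body X' c) Inv
    (33 * (n * m)) _ _ i (S, exact_scores X' S).
- move=> j st [_ _ cS _]; apply: dominant_split_body_ex.
  by rewrite -cards_eq0 cS -lt0n.
- move=> j [T Yl] x t [/= -> uT cT gt] b; split.
    exact: dominant_split_body_cost b.
  move=> st xst; move: b; rewrite xst => /dominant_split_step -/(_ uT).
  case=> h1 h2 h3 h4; rewrite cT in h3.
  case: j gt => [|j] gt; last first.
    exists j; split=> //; apply: lt_trans gt _.
    rewrite exprSr -mulrA ltr_pM2l // exprn_gt0 // mulr_gt0 //.
      exact: lt_trans c1.
    exact: lt_trans c1.
  have := lt_trans gt h4 => /lt_le_trans /(_ (opt' _ h3)).
  by rewrite ltxx.
- by split=> //=; rewrite ltr_pM2r // det_gram_gt0.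
have n0 : (0 < n)%N := leq_trans m0 mn.
exists i.+1; split.
  exists o, (tq + ((init_scores X' S).2 + t))%N, X', tq.
  exists ((init_scores X' S).2 + t)%N; split=> //.
  exists (init_scores X' S).1, (init_scores X' S).2, t.
  by rewrite {2}init_scores_val.
move=> o' t' [_ [_ [? [[-> ->] + ->]]]].
move=> [_ [_ [u [[-> ->] + ->]]]].
rewrite init_scores_val // => /all [oN uB]; split=> //.
have sB := init_scores_cost X' S m0 mn.
have lc0 : 0 < Num.min 1 (ln c) by rewrite lt_min ltr01 ln_gt0.
have lc1 : Num.min 1 (ln c) <= 1 by rewrite ge_min lexx.
move: (Num.min _ _) lc0 lc1 iB => lc lc0 lc1 iB.
(* 219 = 8 + 13 + 6 * 33: LQ, initial scores, and at most 6 m / lc rounds of 33 n m operations. *)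
apply: (@le_trans _ _ ((21 * (n * m ^ 2) + i.+1 * (33 * (n * m)))%:R)).
  rewrite ler_nat (_ : (21 * _ = 8 * (n * m ^ 2) + 13 * (n * m ^ 2))%N).
    by rewrite -addnA leq_add // leq_add.
  by clear; lia.
rewrite natrD !natrM -[m%:R * m%:R]expr2.
have nm0 : 0 <= n%:R * m%:R ^+ 2 :> R by rewrite mulr_ge0 // exprn_ge0.
apply: (@le_trans _ _ (21 * (n%:R * m%:R ^+ 2 / lc) +
    6 * (m%:R / lc) * (33 * (n%:R * m%:R)))).
  rewrite lerD // ?ler_wpM2l //; first by rewrite ler_pdivlMr // ler_piMr.
  by rewrite ler_wpM2r // mulr_ge0 // mulr_ge0.
rewrite le_eqVlt; apply/orP; left; apply/eqP; field.
by rewrite gt_eqF.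
Qed.

Lemma Vol_gram (R : realType) (m n : nat) (X : 'M[R]_(m, n))
    (S : {set 'I_n}) : Vol X S = Num.sqrt (\det (gram X S)).
Proof. by rewrite /Vol colset_gram. Qed.

Lemma mul_VolE (R : realType) (m n : nat) (X : 'M[R]_(m, n)) (c : R)
    (S : {set 'I_n}) : 0 <= c ->
  c * Vol X S = Num.sqrt (c * c * \det (gram X S)).
Proof.
move=> c0; rewrite sqrtrM ?mulr_ge0 // -expr2 sqrtr_sqr ger0_norm //.
by rewrite Vol_gram.
Qed.

(** This ties the table-driven program to the algorithm stated in terms of volumes, so that the cost
    bound concerns the latter. *)
Lemma dominant_loop_result (R : realType) (m n : nat) (X : 'M[R]_(m, n))
    (c : R) : 0 <= c -> forall N (S S' : {set 'I_n}) t,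
  gram X S \in unitmx ->
  loop (dominant_body c) N (S, exact_swap_scores X S) (Some S') t ->
  dominant_result X c S S'.
Proof.
move=> c0; elim=> [|N IH] S S' t uG; first by case.
case=> x [t1 [t2 [b + _]]]; have := dominant_step uG b; case: x b => [st|T] b.
  case=> s [r [sS rS -> uG' [lt smax]]] /(IH _ _ _ uG').
  apply: Dominant_swap => // [s' r' s'S r'S|].
    by rewrite !Vol_gram ler_wsqrtr // smax.
  by rewrite mul_VolE // Vol_gram ltr_sqrt // det_gram_gt0.
case=> -> le [[->] _]; apply: Dominant_stop => s r sS rS.
by rewrite mul_VolE // Vol_gram ler_wsqrtr // le.
Qed.

Lemma dominant_halts (R : realType) (m n : nat) (X : 'M[R]_(m, n)) (c : R)
    (S : {set 'I_n}) : (0 < m)%N -> (m <= n)%N -> (m <= #|S|)%N -> 1 < c ->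
  gram X S \in unitmx ->
  (forall T : {set 'I_n}, #|T| = #|S| ->
     \det (gram X T) <= 24 ^+ m * \det (gram X S)) ->
  halts_within (dominant X S c)
    (183 * (n%:R * #|S|%:R * m%:R / Num.min 1 (ln c))).
Proof.
move=> m0 mn mS c1 uG opt; have [i [i24 iB]] := rounds_exist m0 c1.
have S0 : (0 < #|S|)%N := leq_trans m0 mS.
pose Inv j (st : {set 'I_n} * ({ffun 'I_n -> R} * {ffun 'I_n * 'I_n -> R})) :=
  [/\ st = (st.1, exact_swap_scores X st.1), gram X st.1 \in unitmx,
      #|st.1| = #|S| &
      24 ^+ m * \det (gram X S) < (c * c) ^+ j.+1 * \det (gram X st.1)].
have [|||[o [t l]] all] := @loop_halts _ _ (dominant_body c) Inv
    (28 * (n * #|S|)) _ _ i (S, exact_swap_scores X S).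
- move=> j st [_ _ cS _]; apply: dominant_body_ex.
  by rewrite -cards_eq0 cS -lt0n.
- move=> j [T Yl] x t [/= -> uT cT gt] b; split.
    by rewrite -cT; exact: dominant_body_cost b.
  move=> st xst; move: b; rewrite xst => /dominant_step -/(_ uT).
  case=> s [r [sT rT -> h2 [h4 _]]].
  have h3 : #|swap T s r| = #|S| by rewrite card_swap.
  case: j gt => [|j] gt; last first.
    exists j; split=> //; apply: lt_trans gt _.
    rewrite exprSr -mulrA ltr_pM2l // exprn_gt0 // mulr_gt0 //.
      exact: lt_trans c1.
    exact: lt_trans c1.
  have := lt_trans gt h4 => /lt_le_trans /(_ (opt _ h3)).
  by rewrite ltxx.
- by split=> //=; rewrite ltr_pM2r // det_gram_gt0.
exists i.+1; split.
  exists o, ((init_swap_scores X S).2 + t)%N.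
  exists (init_swap_scores X S).1, (init_swap_scores X S).2, t.
  by rewrite {2}init_swap_scores_val.
move=> o' t' [_ [_ [u [[-> ->] + ->]]]].
rewrite init_swap_scores_val // => /all [oN uB]; split=> //.
have sB := init_swap_scores_cost X m0 mn mS.
have lc0 : 0 < Num.min 1 (ln c) by rewrite lt_min ltr01 ln_gt0.
have lc1 : Num.min 1 (ln c) <= 1 by rewrite ge_min lexx.
move: (Num.min _ _) lc0 lc1 iB => lc lc0 lc1 iB.
(* 183 = 15 + 6 * 28: initial tables and at most 6 m / lc rounds of 28 n #|S| operations. *)
apply: (@le_trans _ _ ((15 * (n * #|S| * m) + i.+1 * (28 * (n * #|S|)))%:R)).
  by rewrite ler_nat leq_add.
rewrite natrD !natrM.
have nm0 : 0 <= n%:R * #|S|%:R * m%:R :> R by rewrite !mulr_ge0.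
apply: (@le_trans _ _ (15 * (n%:R * #|S|%:R * m%:R / lc) +
    6 * (m%:R / lc) * (28 * (n%:R * #|S|%:R)))).
  rewrite lerD // ?ler_wpM2l //; first by rewrite ler_pdivlMr // ler_piMr.
  by rewrite ler_wpM2r // mulr_ge0 // mulr_ge0.
rewrite le_eqVlt; apply/orP; left; apply/eqP; field.
by rewrite gt_eqF.
Qed.

Theorem theorem3 (R : realType) :
  exists K : R, 0 < K /\
  forall (m n k : nat) (X : 'M[R]_(m, n)) (c : R) (lq0 lq : bool)
    (S : {set 'I_n}),
  (0 < m)%N -> (m <= n)%N -> \rank X = m ->
  (m <= k)%N -> (k <= n)%N -> 1 < c ->
  advanced_init lq0 X k S ->
  [/\ halts_within (dominant_split lq X S c)
        (K * (n%:R * m%:R ^+ 2 / Num.min 1 (ln c))),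
      halts_within (dominant X S c)
        (K * (n%:R * k%:R * m%:R / Num.min 1 (ln c))) &
      forall S' : {set 'I_n},
        outputs (dominant X S c) S' -> dominant_result X c S S'].
Proof.
(* The larger of 219 and 183, so that one constant serves both algorithms. *)
exists 219; split=> // m n k X c lq0 lq S m0 mn rX mk kn c1 init.
have [uG cS opt] := advanced_init_bound m0 rX mk kn init.
have opt' (T : {set 'I_n}) : #|T| = #|S| ->
    \det (gram X T) <= 24 ^+ m * \det (gram X S) by rewrite cS; apply: opt.
split; first exact: dominant_split_halts.
  have mS : (m <= #|S|)%N by rewrite cS.
  have [N [ex all]] := dominant_halts m0 mn mS c1 uG opt'.
  exists N; split=> // o t /all [oN tB]; split=> //; apply: le_trans tB _.
  have lc0 : 0 < Num.min 1 (ln c) by rewrite lt_min ltr01 ln_gt0.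
  by rewrite cS ler_wpM2r ?ler_nat // divr_ge0 ?mulr_ge0 // ltW.
move=> S' [N [t [_ [? [? [[-> _] + _]]]]]]; rewrite init_swap_scores_val //.
by apply: dominant_loop_result => //; apply/ltW/(lt_trans _ c1).
Qed.
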